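(* Let $k \geq 2$ be an even integer. Let $q$ be a prime power such that $q \equiv k+1 \pmod{2k}$. Then $$\mathcal{K}_4(G_k(q)) = \frac{q(q-1)}{k^6} \Biggl[ 10 \, \mathbb{R}_k(q)^2 + 5 \left( q-k^2+1\right) \mathbb{R}_k(q) -10 \, \mathbb{S}_k(q) -5 \, \mathbb{S}^{-}_k(q) +q^2-10 (k-1)^2 q + 5k^2(k-1)+1 +q^2 \sum_{\vec{t} \in X_k} {_{3}F_2}\left( \vec{t} \; \big| \; 1 \right)_{q,k} \Biggr],$$ where $$X_k := \{ (t_1,t_2,t_3,t_4,t_5) \in (\mathbb{Z}_{k})^{5} \mid t_1,t_2,t_3 \neq 0, t_4,t_5 \, ; \, t_1+t_2+t_3 \neq t_4+t_5 \}$$ (that is, each of $t_1,t_2,t_3$ is different from each of $0,t_4,t_5$, and $t_1+t_2+t_3\neq t_4+t_5$ in $\mathbb{Z}_k$), $$\mathbb{R}_k(q) := \sum_{\substack{s,t=1 \\ s+t \not\equiv 0 \, (k)}}^{k-1} J(\chi_k^s, \chi_k^t), \qquad \mathbb{S}_k(q) := \sum_{\substack{s,t,v=1 \\ s+t,\, v+t,\, v-s \not\equiv 0 \, (k)}}^{k-1} J(\chi_k^s, \chi_k^t)\, J(\bar{\chi_k}^s, \chi_k^v),$$ and $$\mathbb{S}^{-}_k(q) := \sum_{\substack{s,t,v=1 \\ s+t,\, v+t,\, v-s \not\equiv 0 \, (k)}}^{k-1} (-1)^{s+t} J(\chi_k^s, \chi_k^t)\, J(\bar{\chi_k}^s, 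\chi_k^v).$$
   Context: $\mathbb{F}_q$ is the finite field with $q$ elements and $S_k \subset \mathbb{F}_q^*$ is the subgroup of nonzero $k$-th powers (of order $\frac{q-1}{k}$). The $k$-th power Paley digraph $G_k(q)$ has vertex set $\mathbb{F}_q$, and $a \to b$ is an edge if and only if $b-a \in S_k$ (the condition on $q$ gives $-1 \notin S_k$, so there is at most one edge between any two vertices). For a digraph $G$, $\mathcal{K}_m(G)$ is the number of transitive subtournaments of order $m$ contained in $G$; a tournament of order $m$ is transitive if its vertices can be listed $a_1,\dots,a_m$ with $a_i \to a_j$ for all $i<j$. Every multiplicative character $\chi$ of $\mathbb{F}_q^*$ (complex-valued), including the trivial character $\varepsilon$, is extended to $\mathbb{F}_q$ by $\chi(0):=0$; $\bar{\chi}$ is the inverse of $\chi$. For characters $A,B$ define the Jacobi sum $J(A,B):=\sum_{a \in \mathbb{F}_q} A(a)B(1-a)$ and $\binom{A}{B} := \frac{B(-1)}{q} J(A,\bar{B})$. For characters $A_0,\dots,A_n,B_1,\dots,B_n$ of $\mathbb{F}_q^*$ and $\lambda\in\mathbb{F}_q$, Greene's finite field hypergeometric function is $${_{n+1}F_n}\left( \begin{array}{cccc} A_0, & A_1, & \dotsc, & A_n \\ & B_1, & \dotsc, & B_n \end{array} \Big| \; \lambda \right)_{q} := \frac{q}{q-1} \sum_{\chi} \binom{A_0 \chi}{\chi} \binom{A_1 \chi}{B_1 \chi} \dotsm \binom{A_n \chi}{B_n \chi} \chi(\lambda),$$ the sum being over all multiplicative characters $\chi$ of $\mathbb{F}_q^*$.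 Let $\chi_k$ be a fixed character of $\mathbb{F}_q^*$ of order $k$. For $\vec{t}=(t_1,t_2,t_3,t_4,t_5) \in (\mathbb{Z}_k)^5$, where $\mathbb{Z}_k=\mathbb{Z}/k\mathbb{Z}$, $${_{3}F_2}\left( \vec{t} \; \big| \; \lambda \right)_{q,k} := (-1)^{t_3+t_5}\, {_{3}F_2}\left( \begin{array}{ccc} \chi_k^{t_1}, & \chi_k^{t_2}, & \chi_k^{t_3} \\ & \chi_k^{t_4}, & \chi_k^{t_5} \end{array} \Big| \; \lambda \right)_{q}.$$ *)

(* Defs.v *)
From HB Require Import structures.
From mathcomp Require Import all_boot all_order all_fingroup all_algebra.
From mathcomp Require Import all_solvable all_field all_character.

Set Implicit Arguments.
Unset Strict Implicit.
Unset Printing Implicit Defensive.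

Import GRing.Theory Num.Theory.
Local Open Scope ring_scope.

(* Digraphs are relations [e] on a finite type [V].  A subgraph is a pair
   made of its vertex set [A] and its edge set [E]. *)

Section Tournaments.
Variable V : finType.

Definition is_tournament (A : {set V}) (E : {set V * V}) : bool :=
  [forall p in E, [&& p.1 \in A, p.2 \in A & p.1 != p.2]] &&
  [forall x in A, forall y in A,
     (x != y) ==> (((x, y) \in E) (+) ((y, x) \in E))].

Definition is_transitive (m : nat) (A : {set V}) (E : {set V * V}) : bool :=
  [exists a : m.-tuple V, (A == [set x in a]) &&
     [forall i : 'I_m, forall j : 'I_m,
        (i < j)%N ==> ((tnth a i, tnth a j) \in E)]].

Definition num_transitive_subtournaments (m : nat) (e : rel V) : nat :=
  #|[set T : {set V} * {set V * V} |
      [&& #|T.1| == m, is_tournament T.1 T.2, is_transitive m T.1 T.2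
        & [forall p in T.2, e p.1 p.2]]]|.

End Tournaments.

Section FiniteField.
Variable F : finFieldType.

Definition kth_powers (k : nat) : {set F} :=
  [set x | [exists y : F, (y != 0) && (x == y ^+ k)]].

Definition paley_digraph (k : nat) : rel F :=
  fun a b => b - a \in kth_powers k.

(* Multiplicative characters of F are the linear characters of the group of
   units of F, seen inside the algebra of its class functions, where product
   and inverse are pointwise. *)
Definition unit_cfun := 'CF([set: {unit F}]).

Definition mulchar_ext (A : unit_cfun) (x : F) : algC :=
  if insub x is Some u then A u else 0.

Definition jacobi (A B : unit_cfun) : algC :=
  \sum_(a : F) mulchar_ext A a * mulchar_ext B (1 - a).

Definition greene_binom (A B : unit_cfun) : algC :=
  mulchar_ext B (-1) / #|F|%:R * jacobi A B^-1.

(* Since the group of units is abelian, its irreducible characters are exactly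
   its linear characters, so the sum is over all multiplicative characters.
   The tuples are A_0, ..., A_n and B_1, ..., B_n. *)
Definition greene_hypergeometric (n : nat) (A : n.+1.-tuple unit_cfun)
    (B : n.-tuple unit_cfun) (x : F) : algC :=
  #|F|%:R / (#|F|%:R - 1) *
  \sum_(i : Iirr [set: {unit F}])
    (greene_binom (thead A * 'chi_i) 'chi_i *
     \prod_(j < n)
       greene_binom (tnth A (lift ord0 j) * 'chi_i) (tnth B j * 'chi_i)) *
    mulchar_ext 'chi_i x.

Definition index5 (k : nat) : finType := ('Z_k * 'Z_k * 'Z_k * 'Z_k * 'Z_k)%type.

(* For a character of order k with k > 1 even, the powers of the character
   and of -1 do not depend on the representatives of the classes modulo k. *)
Definition hyp3F2 (k : nat) (chi : unit_cfun) (t : index5 k) (x : F) : algC :=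
  let: (t1, t2, t3, t4, t5) := t in
  (-1) ^+ (t3 + t5)%N *
  greene_hypergeometric [tuple chi ^+ t1; chi ^+ t2; chi ^+ t3]
                        [tuple chi ^+ t4; chi ^+ t5] x.

Definition Xset (k : nat) : {set index5 k} :=
  [set t | let: (t1, t2, t3, t4, t5) := t in
    [&& t1 \notin [:: 0; t4; t5], t2 \notin [:: 0; t4; t5],
        t3 \notin [:: 0; t4; t5] & t1 + t2 + t3 != t4 + t5]].

Definition Rsum (k : nat) (chi : unit_cfun) : algC :=
  \sum_(1 <= s < k) \sum_(1 <= t < k | ~~ (k %| s + t)%N)
    jacobi (chi ^+ s) (chi ^+ t).

Definition Ssum (k : nat) (chi : unit_cfun) : algC :=
  \sum_(1 <= s < k) \sum_(1 <= t < k) \sum_(1 <= v < k |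
      [&& ~~ (k %| s + t)%N, ~~ (k %| v + t)%N & (v != s %[mod k])%N])
    jacobi (chi ^+ s) (chi ^+ t) * jacobi (chi^-1 ^+ s) (chi ^+ v).

Definition Ssum_minus (k : nat) (chi : unit_cfun) : algC :=
  \sum_(1 <= s < k) \sum_(1 <= t < k) \sum_(1 <= v < k |
      [&& ~~ (k %| s + t)%N, ~~ (k %| v + t)%N & (v != s %[mod k])%N])
    (-1) ^+ (s + t)%N *
    (jacobi (chi ^+ s) (chi ^+ t) * jacobi (chi^-1 ^+ s) (chi ^+ v)).

End FiniteField.

(* Main.v *)
Require Import Defs.
From HB Require Import structures.
From mathcomp Require Import all_boot all_order all_fingroup all_algebra.
From mathcomp Require Import all_solvable all_field all_character.
From mathcomp Require Import ring zify.
Import GRing.Theory Num.Theory.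
Local Open Scope ring_scope.
Set Implicit Arguments.
Unset Strict Implicit.
Unset Printing Implicit Defensive.

(** The six differences of the vertices of a path a1 -> a2 -> a3 -> a4 must all
    be k-th powers.  As -1 is not a k-th power (this is where
    q = k + 1 mod 2k is used), the edge relation is asymmetric, so that a
    transitive subtournament has a unique ordering and only such 4-tuples have
    to be counted.  Put a = (a2 - a1)/(a3 - a1) and b = (a3 - a1)/(a4 - a1).
    The differences are k-th powers if and only if a2 - a1 and the five numbers
      y1 = a,  y2 = 1 - ab,  y3 = b,  y4 = (1 - b)/(1 - ab),  y5 = (1 - a)/(1 - ab)
    are.  Detecting k-th powers with the characters chi^t, the number of
    subtournaments is q (q - 1) / k^6 times the sum over all t in (Z/k)^5 of
      M(t) = sum over (a, b) of chi^t1(y1) ... chi^t5(y5)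
    ([num_transitive4_M05sum]).

    The y_i are coordinates on the moduli space of five points of the
    projective line: they satisfy y_(i-1) y_(i+1) = 1 - y_i with indices
    modulo 5, so M is invariant under cyclic shifts of t ([M05sum_cyc]).
    Expanding Jacobi sums and using the orthogonality of characters shows that
    q^2 3F2(.|1) is M after a linear change of the parameters
    ([hyp3F2_M05sum]), which turns X_k into the set of the t for which the ten
    forms t_i and p_i = t_(i-2) + t_(i+2) - t_i, one for each boundary divisor
    of the moduli space, are all nonzero ([sum_Xset]).

    It remains to sum M over the other t.  If t_i = 0 or p_i = 0, then M(t) is
    a product of two Jacobi sums minus, up to a sign, a third one ([M05sum_t4],
    [M05sum_p2]).  Inclusion-exclusion is applied to the vanishing of the t_i,
    and then, among the t with all t_i nonzero, to the vanishing of the p_i,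
    three cyclically consecutive ones of which never vanish together
    ([incl_excl]).  By the cyclic symmetry eleven sums are left.  They are
    evaluated with the reflection J(A, B) = A(-1) J(A, 1/(AB)) and the norm
    relation J(A, B) J(1/A, 1/B) = q, which is itself a consequence of the
    cyclic symmetry ([jac_norm]). *)

(** * Finite sums *)

(** Change of variables between two conditional sums along a pair of mutually
    inverse maps, inverse only where the conditions hold. *)
Lemma eq_reindex (R : nmodType) (I L : finType) (h : L -> I) (h' : I -> L)
    (P : pred I) (Q : pred L) (f : I -> R) (g : L -> R) :
    (forall i, P i -> Q (h' i) /\ h (h' i) = i) ->
    (forall j, Q j -> [/\ P (h j), h' (h j) = j & f (h j) = g j]) ->
  \sum_(i | P i) f i = \sum_(j | Q j) g j.
Proof.
move=> hP hQ; rewrite (reindex_onto h h') => [|i /hP[]//].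
apply: eq_big => [j|j /andP[/hP[Qj _] /eqP e]]; last first.
  by rewrite e in Qj; case/hQ: Qj.
by apply/andP/idP => [[/hP[Qj _] /eqP e]|/hQ[Pj -> _]//]; rewrite -e.
Qed.

Lemma sum_subset_supp (R : nmodType) (I : finType) (P : pred I) (f : I -> R) :
  (forall i, ~~ P i -> f i = 0) -> \sum_i f i = \sum_(i | P i) f i.
Proof.
by move=> h; rewrite [RHS]big_mkcond; apply: eq_bigr => i _; case: ifPn => // /h.
Qed.

Lemma sum_delta (R : pzSemiRingType) (I : finType) (f : I -> R) (c : I) :
  \sum_i f i * (i == c)%:R = f c.
Proof.
rewrite (bigD1 c) //= eqxx mulr1 big1 ?addr0 // => i /negPf->.
by rewrite mulr0.
Qed.

Lemma sum_neq (R : zmodType) (I : finType) (c : I) (f : I -> R) :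
  \sum_(i | i != c) f i = \sum_i f i - f c.
Proof. by rewrite [X in _ = X - _](bigD1 c) //= addrAC subrr add0r. Qed.

Lemma sum_neq2 (R : zmodType) (I : finType) (c d : I) (f : I -> R) : c != d ->
  \sum_(i | (i != c) && (i != d)) f i = \sum_i f i - f c - f d.
Proof.
move=> cd; rewrite -sum_neq [X in _ = X - _](bigD1 d) 1?eq_sym //=.
by rewrite addrAC subrr add0r.
Qed.

Lemma eqr_of_subr (Z : zmodType) (a b c d : Z) :
  a - b = c - d -> (a == b) = (c == d).
Proof. by move=> e; rewrite -subr_eq0 e subr_eq0. Qed.

(** * Characters and Jacobi sums *)

Section PowerCharacters.

(** [psi a] stands for the character chi^a, extended by 0 at 0, for an exponent
    [a] in a finite group [Z], here Z/k.  Only the addition of [Z] matters.  The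
    last two hypotheses say that distinct exponents give distinct characters and
    that some [psi a] is nontrivial at -1. *)
Variables (F : finFieldType) (Z : finComNzRingType) (psi : Z -> F -> algC).
Hypotheses (psi0r : forall a, psi a 0 = 0)
  (psi0l : forall x, x != 0 -> psi 0 x = 1)
  (psiM : forall a x y, psi a (x * y) = psi a x * psi a y)
  (psiD : forall a b x, psi (a + b) x = psi a x * psi b x)
  (psi_sum0 : forall a, a != 0 -> \sum_x psi a x = 0)
  (psiN1_sum0 : \sum_a psi a (-1) = 0).

Local Notation q := (#|F|%:R : algC).
Local Notation K := (#|Z|%:R : algC).

Lemma psi_neq0 a x : x != 0 -> psi a x != 0.
Proof.
move=> x0; apply: contraTneq (oner_neq0 algC) => pax.
by rewrite -(psi0l x0) -(subrr a) psiD pax mul0r eqxx.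
Qed.

Lemma psi1 a : psi a 1 = 1.
Proof.
apply: (mulfI (psi_neq0 a (oner_neq0 F))).
by rewrite -psiM !mulr1.
Qed.

Lemma psi0lE x : psi 0 x = (x != 0)%:R.
Proof. by have [->|x0] := eqVneq x 0; rewrite ?psi0r ?psi0l. Qed.

Lemma psiNl a x : psi (- a) x = (psi a x)^-1.
Proof.
have [->|x0] := eqVneq x 0; first by rewrite !psi0r invr0.
apply: (mulfI (psi_neq0 a x0)).
by rewrite -psiD subrr psi0l // mulfV ?psi_neq0.
Qed.

Lemma psiV a x : psi a x^-1 = (psi a x)^-1.
Proof.
have [->|x0] := eqVneq x 0; first by rewrite invr0 psi0r invr0.
apply: (mulfI (psi_neq0 a x0)).
by rewrite -psiM !mulfV ?psi_neq0 ?psi1.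
Qed.

(** The sign character of the group of exponents, (-1)^a for Z/k. *)
Definition sgn a := psi a (-1).

Lemma sgn_sq a : sgn a * sgn a = 1.
Proof. by rewrite -psiM mulrNN mulr1 psi1. Qed.
Lemma sgnD a b : sgn (a + b) = sgn a * sgn b.
Proof. exact: psiD. Qed.
Lemma sgn0 : sgn 0 = 1.
Proof. by rewrite /sgn psi0l // oppr_eq0 oner_eq0. Qed.
Lemma sgnN a : sgn (- a) = sgn a.
Proof. by rewrite /sgn psiNl -psiV invrN invr1. Qed.
Lemma psiNr a x : psi a (- x) = sgn a * psi a x.
Proof. by rewrite -mulN1r psiM. Qed.

(** The Jacobi sum of [psi a] and [psi b]. *)
Definition jac a b := \sum_(x : F) psi a x * psi b (1 - x).

Lemma jac_sym a b : jac a b = jac b a.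
Proof.
rewrite /jac (reindex_inj (inv_inj (@subKr F 1))) /=.
by apply: eq_bigr => x _; rewrite mulrC subKr.
Qed.

(** Substitute 1/x for x. *)
Lemma jac_reflr a b : jac a b = sgn b * jac (- a - b) b.
Proof.
rewrite /jac (reindex_inj invr_inj) /= mulr_sumr; apply: eq_bigr => x _.
have [->|x0] := eqVneq x 0; first by rewrite invr0 !psi0r !mul0r mulr0.
have -> : 1 - x^-1 = - ((1 - x) * x^-1) by field.
by rewrite psiNr psiM !psiD !psiNl !psiV; ring.
Qed.

Lemma jac_refll a b : jac a b = sgn a * jac a (- a - b).
Proof. by rewrite jac_sym jac_reflr jac_sym; congr (_ * jac _ _); ring. Qed.

Lemma jac00 : jac 0 0 = q - 2.
Proof.
have -> : jac 0 0 = \sum_(x : F | (x != 0) && (x != 1)) 1.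
  rewrite /jac [RHS]big_mkcond; apply: eq_bigr => x _.
  rewrite !psi0lE subr_eq0 [1 == x]eq_sym.
  by case: (x != 0); case: (x != 1); rewrite ?mulr1 ?mulr0 ?mul0r.
rewrite sum_neq2 1?eq_sym ?oner_neq0 // sumr_const.
by rewrite -addrA -opprD.
Qed.

Lemma jac0l b : b != 0 -> jac 0 b = -1.
Proof.
move=> b0.
have -> : jac 0 b = \sum_(x : F | x != 0) psi b (1 - x).
  rewrite /jac [RHS]big_mkcond; apply: eq_bigr => x _.
  by rewrite psi0lE; case: (x != 0); rewrite ?mul1r ?mul0r.
rewrite sum_neq subr0 psi1.
by rewrite (reindex_inj (inv_inj (@subKr F 1))) /=;
  under eq_bigr do rewrite subKr; rewrite psi_sum0 // sub0r.
Qed.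

Lemma jac0r a : a != 0 -> jac a 0 = -1.
Proof. by rewrite jac_sym; exact: jac0l. Qed.

Lemma jacN a : a != 0 -> jac a (- a) = - sgn a.
Proof. by move=> a0; rewrite jac_refll opprK addNr jac0r // mulrN1. Qed.

(** * Character sums over the moduli space of five points *)

(** The sum M(t) over the five coordinates y1, ..., y5 of the point (a, b).
    The points outside [M05] contribute 0, because [psi] vanishes at 0 and a
    quotient with zero denominator is 0. *)
Definition M05sum t1 t2 t3 t4 t5 :=
  \sum_(p : F * F) psi t1 p.1 * psi t2 (1 - p.1 * p.2) * psi t3 p.2 *
    psi t4 ((1 - p.2) / (1 - p.1 * p.2)) * psi t5 ((1 - p.1) / (1 - p.1 * p.2)).

(** The pairs (a, b) all of whose five coordinates are defined and nonzero. *)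
Definition M05 : pred (F * F) := fun p =>
  [&& p.1 != 0, p.2 != 0, 1 - p.1 != 0, 1 - p.2 != 0 & 1 - p.1 * p.2 != 0].

Lemma M05sumE t1 t2 t3 t4 t5 : M05sum t1 t2 t3 t4 t5 =
  \sum_(p | M05 p) psi t1 p.1 * psi t2 (1 - p.1 * p.2) * psi t3 p.2 *
    psi t4 ((1 - p.2) / (1 - p.1 * p.2)) * psi t5 ((1 - p.1) / (1 - p.1 * p.2)).
Proof.
apply: sum_subset_supp => -[a b]; rewrite /M05 /= => h.
have [->|a0] := eqVneq a 0; first by rewrite psi0r !mul0r.
have [->|b0] := eqVneq b 0; first by rewrite (psi0r t3) mulr0 !mul0r.
have [e|a1] := eqVneq (1 - a) 0; first by rewrite e mul0r (psi0r t5) mulr0.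
have [e|b1] := eqVneq (1 - b) 0; first by rewrite e mul0r (psi0r t4) mulr0 mul0r.
have [e|ab1] := eqVneq (1 - a * b) 0; first by rewrite e (psi0r t2) mulr0 !mul0r.
by rewrite a0 b0 a1 b1 ab1 in h.
Qed.

(** The shift of the coordinates is induced by the substitution
    (a, b) := (y2, y4), whose inverse is (a, b) := (y5, y2). *)
Lemma M05sum_cyc t1 t2 t3 t4 t5 : M05sum t2 t3 t4 t5 t1 = M05sum t1 t2 t3 t4 t5.
Proof.
rewrite !M05sumE.
pose h (p : F * F) := (1 - p.1 * p.2, (1 - p.2) / (1 - p.1 * p.2)).
pose h' (p : F * F) := ((1 - p.1) / (1 - p.1 * p.2), 1 - p.1 * p.2).
have e1 a b : M05 (a, b) -> 1 - (1 - a * b) * ((1 - b) / (1 - a * b)) = b.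
  by case/and5P=> /= *; field.
have e2 a b : M05 (a, b) -> 1 - (1 - a) / (1 - a * b) * (1 - a * b) = a.
  by case/and5P=> /= *; field.
have f1 a b : M05 (a, b) -> 1 - (1 - b) / (1 - a * b) = b * ((1 - a) / (1 - a * b)).
  by case/and5P=> /= *; field.
have f2 a b : M05 (a, b) -> 1 - (1 - a) / (1 - a * b) = a * ((1 - b) / (1 - a * b)).
  by case/and5P=> /= *; field.
apply: (eq_reindex (h := h) (h' := h')).
- move=> [a b] Hp; split; rewrite /h /= ?(e2 _ _ Hp); last first.
    by congr (_, _); case/and5P: Hp => /= *; field.
  rewrite /h' /M05 /= (e2 _ _ Hp) (f2 _ _ Hp) subKr.
  by rewrite !mulf_eq0 !invr_eq0 !negb_or; case/and5P: Hp => /= -> -> -> -> ->.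
move=> [a b] Hp; split; rewrite /h' /h /= ?(e1 _ _ Hp).
- rewrite /M05 /= (e1 _ _ Hp) (f1 _ _ Hp) subKr.
  by rewrite !mulf_eq0 !invr_eq0 !negb_or; case/and5P: Hp => /= -> -> -> -> ->.
- by congr (_, _); case/and5P: Hp => /= *; field.
rewrite (f1 _ _ Hp); case/and5P: Hp => /= a0 b0 _ _ ab.
have -> : b * ((1 - a) / (1 - a * b)) / b = (1 - a) / (1 - a * b).
  by field; apply/andP.
have -> : (1 - (1 - a * b)) / b = a by field.
by ring.
Qed.

Lemma pair_sum (f : F -> F -> algC) :
  \sum_(p : F * F) f p.1 p.2 = \sum_a \sum_b f a b.
Proof. by rewrite pair_bigA. Qed.

(** The case p2 = t4 + t5 - t2 = 0: no power of 1 - ab is left, and the sum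
    splits up to the terms with ab = 1. *)
Lemma M05sum_p2 t1 t3 t4 t5 : M05sum t1 (t4 + t5) t3 t4 t5 =
  jac t1 t5 * jac t3 t4 - sgn t4 * jac (t1 - t3 - t4) (t4 + t5).
Proof.
rewrite /M05sum (pair_sum (fun a b => psi t1 a * psi (t4 + t5) (1 - a * b) *
   psi t3 b * psi t4 ((1 - b) / (1 - a * b)) * psi t5 ((1 - a) / (1 - a * b)))).
rewrite /jac mulr_suml mulr_sumr -sumrB; apply: eq_bigr => a _.
rewrite mulr_sumr; have [->|a0] := eqVneq a 0.
  by rewrite !psi0r !big1 ?(mul0r, mulr0, subr0) // => b _; rewrite !mul0r.
rewrite [X in _ = X - _](bigD1 a^-1) //= [LHS](bigD1 a^-1) //=.
rewrite mulfV // subrr psi0r mulr0 !mul0r add0r.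
have -> : psi t1 a * psi t5 (1 - a) * (psi t3 a^-1 * psi t4 (1 - a^-1)) =
    sgn t4 * (psi (t1 - t3 - t4) a * psi (t4 + t5) (1 - a)).
  have -> : 1 - a^-1 = - ((1 - a) / a) by field.
  by rewrite psiNr !psiM !psiD !psiNl !psiV; ring.
rewrite addrAC subrr add0r; apply: eq_bigr => b ba.
have ab : 1 - a * b != 0.
  by rewrite subr_eq0; apply: contra ba => /eqP e; apply/eqP;
     apply: (mulfI a0); rewrite mulfV.
by rewrite !psiM !psiV psiD; field; rewrite !psi_neq0.
Qed.

(** The case t4 = 0: for fixed a the sum over b is a Jacobi sum in ab, up to
    the term with b = 1. *)
Lemma M05sum_t4 t1 t2 t3 t5 : M05sum t1 t2 t3 0 t5 =
  jac (t1 - t3) t5 * jac (t2 - t5) t3 - jac t1 t2.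
Proof.
rewrite /M05sum (pair_sum (fun a b => psi t1 a * psi t2 (1 - a * b) *
   psi t3 b * psi 0 ((1 - b) / (1 - a * b)) * psi t5 ((1 - a) / (1 - a * b)))).
rewrite [jac (t2 - t5) t3]jac_sym {1 3}/jac mulr_suml -sumrB; apply: eq_bigr => a _.
have [->|a0] := eqVneq a 0.
  by rewrite !psi0r !mul0r subrr big1 // => b _; rewrite !mul0r.
rewrite /jac [X in _ * X - _](reindex_inj (mulfI a0)) /= mulr_sumr.
rewrite [X in _ = X - _](bigD1 1) //=.
rewrite [LHS](bigD1 1) //= subrr mul0r psi0r !(mulr0, mul0r) add0r.
have -> : psi t1 a * psi t2 (1 - a) = psi (t1 - t3) a * psi t5 (1 - a) *
    (psi t3 (a * 1) * psi (t2 - t5) (1 - a * 1)).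
  rewrite mulr1; have [->|a1] := eqVneq (1 - a) 0.
    by rewrite !psi0r !(mulr0, mul0r).
  by rewrite !psiD !psiNl; field; rewrite !psi_neq0.
rewrite addrAC subrr add0r; apply: eq_bigr => b b1.
have [e|ab] := eqVneq (1 - a * b) 0; first by rewrite e !psi0r !(mulr0, mul0r).
rewrite psi0l ?mulf_neq0 ?invr_neq0 // ?subr_eq0 1?eq_sym //.
by rewrite !psiM !psiD !psiNl !psiV; field; rewrite !psi_neq0.
Qed.

Lemma M05sum_p1 t2 t3 t4 t5 : M05sum (t3 + t4) t2 t3 t4 t5 =
  jac t5 t4 * jac t2 t3 - sgn t3 * jac (t5 - t2 - t3) (t3 + t4).
Proof.
have e := M05sum_cyc t5 (t3 + t4) t2 t3 t4.
rewrite e.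
exact: M05sum_p2.
Qed.

(** Compare the two evaluations of M at (0, 0, -a, 0, b) and at its shift
    (-a, 0, b, 0, 0) given by [M05sum_t4]. *)
Lemma jac_norm a b : a != 0 -> b != 0 -> a + b != 0 -> jac a b * jac (- a) (- b) = q.
Proof.
move=> a0 b0 ab0.
have := M05sum_t4 0 0 (- a) b; rewrite M05sum_cyc M05sum_cyc M05sum_cyc M05sum_t4.
rewrite !subr0 !sub0r jac00 !jac0r ?jac0l ?oppr_eq0 -?opprD ?oppr_eq0 //.
rewrite !opprK [jac (- b) _]jac_sym => h.
by rewrite -[LHS](subrK (q - 2)) -h; ring.
Qed.

(** * Sums of Jacobi sums over the exponents *)

Lemma sum_constZ (c : algC) : \sum_(a : Z) c = K * c.
Proof. by rewrite sumr_const mulr_natl. Qed.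

Lemma sum_const_neq (c : algC) : \sum_(a : Z | a != 0) c = (K - 1) * c.
Proof. by rewrite sum_neq sum_constZ; ring. Qed.

Lemma sum_const_neq2 (b : Z) (c : algC) : b != 0 ->
  \sum_(a : Z | (a != 0) && (a != - b)) c = (K - 2) * c.
Proof. by move=> b0; rewrite sum_neq2 ?sum_constZ 1?eq_sym ?oppr_eq0 //; ring. Qed.

Lemma sum_sgn_neq : \sum_(a | a != 0) sgn a = -1.
Proof. by rewrite sum_neq psiN1_sum0 sgn0 sub0r. Qed.

Lemma sum_sgn_neq2 b : b != 0 ->
  \sum_(a | (a != 0) && (a != - b)) sgn a = -1 - sgn b.
Proof.
move=> b0; rewrite sum_neq2 1?eq_sym ?oppr_eq0 //.
by rewrite psiN1_sum0 sgn0 sub0r sgnN.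
Qed.

(** The sum of the Jacobi sums J(s, t) over all s, and over the s for which
    neither s nor s + t is 0. *)
Definition jacrow t := \sum_s jac s t.
Definition jacgen t := \sum_(s | (s != 0) && (s != - t)) jac s t.

Lemma sum_jac_shift c t : \sum_s jac (s - c) t = jacrow t.
Proof. by rewrite /jacrow [RHS](reindex_inj (addIr (- c))). Qed.

Lemma sum_jac_refl c t : \sum_s jac (c - s) t = jacrow t.
Proof. by rewrite /jacrow [RHS](reindex_inj (inv_inj (@subKr Z c))). Qed.

Lemma jacrow_sym s : \sum_t jac s t = jacrow s.
Proof. by apply: eq_bigr => t _; rewrite jac_sym. Qed.

Lemma jacrow0 : jacrow 0 = q - 1 - K.
Proof.
rewrite /jacrow (bigD1 0) //= jac00.
under eq_bigr => s s0 do rewrite jac0r //.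
by rewrite sum_const_neq; ring.
Qed.

Lemma jacrow_gen t : t != 0 -> jacrow t = jacgen t - 1 - sgn t.
Proof.
move=> t0; rewrite /jacgen sum_neq2 1?eq_sym ?oppr_eq0 // jac0l // jac_sym jacN //.
by rewrite /jacrow; ring.
Qed.

Lemma sum_jac_neq0 t : t != 0 -> \sum_(s | s != 0) jac s t = jacgen t - sgn t.
Proof. by move=> t0; rewrite sum_neq -/(jacrow t) jacrow_gen // jac0l //; ring. Qed.

(** The reflection s := - s - t multiplies every term of [jacgen t] by [sgn t]. *)
Lemma sgn_jacgen t : sgn t * jacgen t = jacgen t.
Proof.
have inj : involutive (fun s => - s - t) by move=> s; ring.
rewrite /jacgen mulr_sumr [RHS](reindex_inj (inv_inj inj)) /=.
apply: eq_big => [s|s _]; last first.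
  by rewrite [RHS]jac_reflr; congr (_ * jac _ _); ring.
rewrite -!addr_eq0 andbC; congr (~~ _ && ~~ _).
  by rewrite -oppr_eq0; congr (_ == 0); ring.
by rewrite -oppr_eq0; congr (_ == 0); ring.
Qed.

(** The sums R_k, S_k and S^-_k, and the variant of R_k twisted by
    (-1)^(s + t), which cancels from the final formula. *)
Definition Jsum := \sum_(s | s != 0) \sum_(t | (t != 0) && (t != - s)) jac s t.
Definition Jsum_sgn :=
  \sum_(s | s != 0) \sum_(t | (t != 0) && (t != - s)) sgn (s + t) * jac s t.
Definition JJsum := \sum_(s | s != 0) \sum_(t | (t != 0) && (t != - s))
  \sum_(v | [&& v != 0, v != s & v != - t]) jac s t * jac (- s) v.
Definition JJsum_sgn := \sum_(s | s != 0) \sum_(t | (t != 0) && (t != - s))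
  \sum_(v | [&& v != 0, v != s & v != - t]) sgn (s + t) * (jac s t * jac (- s) v).

Lemma sum_jacgen : \sum_(t | t != 0) jacgen t = Jsum.
Proof. by apply: eq_bigr => t _; apply: eq_bigr => s _; rewrite jac_sym. Qed.

Lemma sum_negZ (f : Z -> algC) : \sum_(t | t != 0) f (- t) = \sum_(t | t != 0) f t.
Proof.
rewrite [RHS](reindex_inj oppr_inj) /=; apply: eq_bigl => t.
by rewrite oppr_eq0.
Qed.

(** The terms with v = - t, absent from S_k, are the norms J(s, t) J(-s, -t) = q. *)
Lemma sum_jacgen_opp :
  \sum_(s | s != 0) jacgen s * jacgen (- s) = JJsum + (K - 1) * (K - 2) * q.
Proof.
have -> : (K - 1) * (K - 2) * q =
  \sum_(s : Z | s != 0) \sum_(t : Z | (t != 0) && (t != - s)) q.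
  under eq_bigr => s s0 do rewrite sum_const_neq2 //.
  by rewrite sum_const_neq; ring.
rewrite /JJsum -big_split; apply: eq_bigr => s s0 /=.
rewrite -big_split /jacgen mulr_suml; apply: eq_bigr => t /andP[t0 ts] /=.
rewrite mulr_sumr (bigD1 (- t)) /=; last first.
  by rewrite oppr_eq0 t0 eqr_opp.
rewrite addrC; congr (_ + _); last first.
  by rewrite jac_norm // addr_eq0.
apply: eq_big => [v|v _]; first by rewrite opprK -andbA.
by rewrite jac_sym (jac_sym v).
Qed.

(** The sums of J(s, t) over all pairs (s, t) and over the pairs (s, 0). *)
Local Notation A := (Jsum + q + 1 - 2 * K).
Local Notation B := (q - 1 - K).

Lemma sum_jacrow : \sum_t jacrow t = A.
Proof.
rewrite (bigD1 0) //= jacrow0; under eq_bigr => t t0 do rewrite jacrow_gen //.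
by rewrite !sumrB sum_jacgen sum_const_neq sum_sgn_neq; ring.
Qed.

Lemma sum_jacrow_opp : \sum_t jacrow (- t) * jacrow t =
  B ^+ 2 + (JJsum + (K - 1) * (K - 2) * q) - 4 * Jsum + 2 * K - 4.
Proof.
rewrite (bigD1 0) //= oppr0 jacrow0.
have e t : t != 0 -> jacrow (- t) * jacrow t = jacgen t * jacgen (- t)
   + 2 * sgn t - 2 * jacgen t - 2 * jacgen (- t) + 2.
  move=> t0; rewrite !jacrow_gen ?oppr_eq0 // sgnN.
  have h1 := sgn_jacgen t; have h2 := sgn_jacgen (- t); rewrite sgnN in h2.
  have -> : (jacgen (- t) - 1 - sgn t) * (jacgen t - 1 - sgn t) =
    jacgen t * jacgen (- t) + 2 * sgn t - jacgen t - sgn t * jacgen t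
    - jacgen (- t) - sgn t * jacgen (- t) + 1 + sgn t * sgn t by ring.
  by rewrite h1 h2 sgn_sq; ring.
rewrite (eq_bigr _ e) !big_split /= sum_jacgen_opp !sumrN -!mulr_sumr.
rewrite (sum_negZ jacgen) sum_jacgen sum_sgn_neq sum_const_neq; ring.
Qed.

(** * The sums with some t_i equal to 0 *)

Local Notation Z5 := (Z * Z * Z * Z * Z)%type.
Definition M05sum5 (t : Z5) :=
  let: (t1, t2, t3, t4, t5) := t in M05sum t1 t2 t3 t4 t5.

(** Up to a cyclic shift a nonempty set of indices is {4}, {3, 4}, {4, 1},
    {3, 4, 5}, {3, 4, 1}, {1, 3, 4, 5} or everything.  For each of them the sum
    of M over the t vanishing at these indices is computed. *)
Lemma sum_z4 : \sum_(t : Z5 | let: (t1, t2, t3, t4, t5) := t in t4 == 0) M05sum5 t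
  = A ^+ 2 - K ^+ 2 * A.
Proof.
transitivity (\sum_t3 \sum_t5 \sum_t1 \sum_t2 M05sum t1 t2 t3 0 t5).
  rewrite 3!pair_big_dep /=.
  apply: (eq_reindex
    (h := fun p => let: (t3, t5, t1, t2) := p in (t1, t2, t3, 0, t5))
    (h' := fun t => let: (t1, t2, t3, t4, t5) := t in (t3, t5, t1, t2))).
    by case=> [[[[t1 t2] t3] t4] t5] /eqP ->.
  by case=> [[[t3 t5] t1] t2] _; split=> //=; rewrite eqxx.
transitivity (\sum_t3 \sum_t5 (jacrow t5 * jacrow t3 - A)).
  apply: eq_bigr => t3 _; apply: eq_bigr => t5 _.
  rewrite -(sum_jac_shift t3) -(sum_jac_shift t5) mulr_suml -sum_jacrow -sumrB.
  apply: eq_bigr => t1 _; rewrite mulr_sumr -jacrow_sym -sumrB.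
  by apply: eq_bigr => t2 _; rewrite M05sum_t4.
under eq_bigr => t3 _ do rewrite sumrB -mulr_suml sum_jacrow sum_constZ.
by rewrite sumrB -mulr_sumr sum_jacrow sum_constZ; ring.
Qed.

Lemma sum_z34 :
  \sum_(t : Z5 | let: (t1, t2, t3, t4, t5) := t in (t3 == 0) && (t4 == 0)) M05sum5 t
  = A * B - K * A.
Proof.
transitivity (\sum_t5 \sum_t1 \sum_t2 M05sum t1 t2 0 0 t5).
  rewrite 2!pair_big_dep /=.
  apply: (eq_reindex
    (h := fun p => let: (t5, t1, t2) := p in (t1, t2, 0, 0, t5))
    (h' := fun t => let: (t1, t2, t3, t4, t5) := t in (t5, t1, t2))).
    by case=> [[[[t1 t2] t3] t4] t5] /andP[/eqP -> /eqP ->].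
  by case=> [[t5 t1] t2] _; split=> //=; rewrite !eqxx.
transitivity (\sum_t5 (jacrow t5 * jacrow 0 - A)).
  apply: eq_bigr => t5 _.
  rewrite -(sum_jac_shift t5 0) -sum_jacrow mulr_suml -sumrB.
  apply: eq_bigr => t1 _; rewrite mulr_sumr -jacrow_sym -sumrB.
  by apply: eq_bigr => t2 _; rewrite M05sum_t4 subr0.
by rewrite sumrB -mulr_suml sum_jacrow sum_constZ jacrow0.
Qed.

Lemma sum_z14 :
  \sum_(t : Z5 | let: (t1, t2, t3, t4, t5) := t in (t4 == 0) && (t1 == 0)) M05sum5 t
  = B ^+ 2 + (JJsum + (K - 1) * (K - 2) * q) - 4 * Jsum + 2 * K - 4 - K ^+ 2 * B.
Proof.
transitivity (\sum_t3 \sum_t5 \sum_t2 M05sum 0 t2 t3 0 t5).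
  rewrite 2!pair_big_dep /=.
  apply: (eq_reindex
    (h := fun p => let: (t3, t5, t2) := p in (0, t2, t3, 0, t5))
    (h' := fun t => let: (t1, t2, t3, t4, t5) := t in (t3, t5, t2))).
    by case=> [[[[t1 t2] t3] t4] t5] /andP[/eqP -> /eqP ->].
  by case=> [[t3 t5] t2] _; split=> //=; rewrite !eqxx.
rewrite -sum_jacrow_opp.
transitivity (\sum_t3 (jacrow (- t3) * jacrow t3 - K * B)); last first.
  by rewrite sumrB sum_constZ; ring.
apply: eq_bigr => t3 _.
rewrite -jacrow0 -sum_constZ -[jacrow (- t3)]jacrow_sym mulr_suml -sumrB.
apply: eq_bigr => t5 _.
rewrite -(sum_jac_shift t5 t3) mulr_sumr -(jacrow_sym 0) -sumrB.
by apply: eq_bigr => t2 _; rewrite M05sum_t4 sub0r.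
Qed.

Lemma sum_z345 :
  \sum_(t : Z5 | let: (t1, t2, t3, t4, t5) := t in
     [&& t3 == 0, t4 == 0 & t5 == 0]) M05sum5 t = B ^+ 2 - A.
Proof.
transitivity (\sum_t1 \sum_t2 M05sum t1 t2 0 0 0).
  rewrite pair_big_dep /=.
  apply: (eq_reindex
    (h := fun p => let: (t1, t2) := p in (t1, t2, 0, 0, 0))
    (h' := fun t => let: (t1, t2, t3, t4, t5) := t in (t1, t2))).
    by case=> [[[[t1 t2] t3] t4] t5] /and3P[/eqP -> /eqP -> /eqP ->].
  by case=> [t1 t2] _; split=> //=; rewrite !eqxx.
rewrite -jacrow0 -sum_jacrow expr2 {1}/jacrow mulr_suml -sumrB.
apply: eq_bigr => t1 _; rewrite mulr_sumr -jacrow_sym -sumrB.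
by apply: eq_bigr => t2 _; rewrite M05sum_t4 !subr0.
Qed.

Lemma sum_z134 :
  \sum_(t : Z5 | let: (t1, t2, t3, t4, t5) := t in
     [&& t3 == 0, t4 == 0 & t1 == 0]) M05sum5 t = B ^+ 2 - K * B.
Proof.
transitivity (\sum_t5 \sum_t2 M05sum 0 t2 0 0 t5).
  rewrite pair_big_dep /=.
  apply: (eq_reindex
    (h := fun p => let: (t5, t2) := p in (0, t2, 0, 0, t5))
    (h' := fun t => let: (t1, t2, t3, t4, t5) := t in (t5, t2))).
    by case=> [[[[t1 t2] t3] t4] t5] /and3P[/eqP -> /eqP -> /eqP ->].
  by case=> [t5 t2] _; split=> //=; rewrite !eqxx.
rewrite -jacrow0 -sum_constZ expr2 -{1}(jacrow_sym 0) mulr_suml -sumrB.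
apply: eq_bigr => t5 _.
rewrite -{1}(sum_jac_shift t5 0) mulr_sumr -(jacrow_sym 0) -sumrB.
by apply: eq_bigr => t2 _; rewrite M05sum_t4 !subr0.
Qed.

Lemma sum_z1345 :
  \sum_(t : Z5 | let: (t1, t2, t3, t4, t5) := t in
     [&& t1 == 0, t3 == 0, t4 == 0 & t5 == 0]) M05sum5 t = (q - 3) * B.
Proof.
transitivity (\sum_t2 M05sum 0 t2 0 0 0).
  apply: (eq_reindex
    (h := fun t2 => (0, t2, 0, 0, 0))
    (h' := fun t => let: (t1, t2, t3, t4, t5) := t in t2)).
    by case=> [[[[t1 t2] t3] t4] t5] /and4P[/eqP -> /eqP -> /eqP -> /eqP ->].
  by move=> t2 _; split=> //=; rewrite !eqxx.
transitivity (\sum_t2 ((q - 2) * jac t2 0 - jac t2 0)).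
  by apply: eq_bigr => t2 _; rewrite M05sum_t4 !subr0 jac00 (jac_sym 0).
by rewrite sumrB -mulr_sumr -/(jacrow 0) jacrow0; ring.
Qed.

Lemma M05sum_0 : M05sum 0 0 0 0 0 = (q - 2) * (q - 3).
Proof. by rewrite M05sum_t4 !subr0 jac00; ring. Qed.

(** * Inclusion-exclusion *)

Definition rot5 (t : Z5) : Z5 :=
  let: (t1, t2, t3, t4, t5) := t in (t2, t3, t4, t5, t1).

Lemma M05sum5_rot t : M05sum5 (rot5 t) = M05sum5 t.
Proof. by case: t => [[[[t1 t2] t3] t4] t5]; apply: M05sum_cyc. Qed.

Lemma sum_rot5 (c : Z5 -> algC) :
  \sum_t M05sum5 t * c (rot5 t) = \sum_t M05sum5 t * c t.
Proof.
pose rotr (t : Z5) : Z5 := let: (t1, t2, t3, t4, t5) := t in (t5, t1, t2, t3, t4).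
have rotK : cancel rot5 rotr by case=> [[[[t1 t2] t3] t4] t5].
rewrite [RHS](reindex_inj (can_inj rotK)) /=.
by apply: eq_bigr => t _; rewrite M05sum5_rot.
Qed.

(** The sum of [c] along the orbit of [t] under the cyclic shift. *)
Definition orbit5 (c : Z5 -> algC) (t : Z5) := c t + c (rot5 t)
  + c (rot5 (rot5 t)) + c (rot5 (rot5 (rot5 t))) + c (rot5 (rot5 (rot5 (rot5 t)))).

Lemma sum_orbit (c : Z5 -> algC) :
  \sum_t M05sum5 t * orbit5 c t = 5 * \sum_t M05sum5 t * c t.
Proof.
have s1 := sum_rot5 c; have s2 := sum_rot5 (c \o rot5).
have s3 := sum_rot5 (c \o rot5 \o rot5).
have s4 := sum_rot5 (c \o rot5 \o rot5 \o rot5).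
rewrite /= in s1 s2 s3 s4.
under eq_bigr => t _ do rewrite /orbit5 !mulrDr.
by rewrite !big_split /= s4 s3 s2 s1; ring.
Qed.

Lemma sum_ind (P : pred Z5) :
  \sum_t M05sum5 t * (P t)%:R = \sum_(t | P t) M05sum5 t.
Proof.
rewrite [RHS]big_mkcond; apply: eq_bigr => t _.
by case: (P t); rewrite ?mulr1 ?mulr0.
Qed.

(** No t_i is 0. *)
Definition allnz (t : Z5) := let: (t1, t2, t3, t4, t5) := t in
  [&& t1 != 0, t2 != 0, t3 != 0, t4 != 0 & t5 != 0].

(** The t for which none of the ten forms t_i, p_i vanishes; this is X_k up to a
    linear change of coordinates. *)
Definition Xgen (t : Z5) := let: (t1, t2, t3, t4, t5) := t in
  [&& allnz t, t3 + t4 != t1, t4 + t5 != t2, t5 + t1 != t3, t1 + t2 != t4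
    & t2 + t3 != t5].

(** One representative, with its sign, of each cyclic class of proper nonempty
    sets of indices i: the orbit sum of [ie_t] together with the term of t = 0
    is the indicator function of the t with some t_i = 0. *)
Definition ie_t (t : Z5) : algC := let: (t1, t2, t3, t4, t5) := t in
  (t4 == 0)%:R - ((t3 == 0) && (t4 == 0))%:R - ((t4 == 0) && (t1 == 0))%:R
  + [&& t3 == 0, t4 == 0 & t5 == 0]%:R + [&& t3 == 0, t4 == 0 & t1 == 0]%:R
  - [&& t1 == 0, t3 == 0, t4 == 0 & t5 == 0]%:R.

(** The same for the vanishing of the p_i among the t with all t_i nonzero.
    A set of indices containing three consecutive ones does not occur, which
    leaves two classes of pairs and one of triples. *)
Definition ie_p (t : Z5) : algC := let: (t1, t2, t3, t4, t5) := t in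
  (allnz t && (t4 + t5 == t2))%:R
  - [&& allnz t, t3 + t4 == t1 & t4 + t5 == t2]%:R
  - [&& allnz t, t4 + t5 == t2 & t1 + t2 == t4]%:R
  + [&& allnz t, t3 + t4 == t1, t5 + t1 == t3 & t1 + t2 == t4]%:R.

Lemma ie_bool5 (z1 z2 z3 z4 z5 : bool) :
  let c (z1 z2 z3 z4 z5 : bool) : algC := z4%:R - (z3 && z4)%:R - (z4 && z1)%:R
    + [&& z3, z4 & z5]%:R + [&& z3, z4 & z1]%:R - [&& z1, z3, z4 & z5]%:R in
  1 - [&& ~~ z1, ~~ z2, ~~ z3, ~~ z4 & ~~ z5]%:R =
  c z1 z2 z3 z4 z5 + c z2 z3 z4 z5 z1 + c z3 z4 z5 z1 z2 + c z4 z5 z1 z2 z3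
  + c z5 z1 z2 z3 z4 + [&& z1, z2, z3, z4 & z5]%:R.
Proof. by case: z1; case: z2; case: z3; case: z4; case: z5; rewrite /=; ring. Qed.

Lemma ie_cyclic5 (n y1 y2 y3 y4 y5 : bool) :
  let d (y1 y2 y3 y4 y5 : bool) : algC := (n && y2)%:R - [&& n, y1 & y2]%:R
    - [&& n, y2 & y4]%:R + [&& n, y1, y3 & y4]%:R in
  ~~ [&& n, y1, y2 & y3] -> ~~ [&& n, y2, y3 & y4] -> ~~ [&& n, y3, y4 & y5] ->
  ~~ [&& n, y4, y5 & y1] -> ~~ [&& n, y5, y1 & y2] ->
  n%:R - [&& n, ~~ y1, ~~ y2, ~~ y3, ~~ y4 & ~~ y5]%:R =
  d y1 y2 y3 y4 y5 + d y2 y3 y4 y5 y1 + d y3 y4 y5 y1 y2 + d y4 y5 y1 y2 y3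
  + d y5 y1 y2 y3 y4.
Proof.
by case: n; case: y1; case: y2; case: y3; case: y4; case: y5;
  move=> //= _ _ _ _ _; ring.
Qed.

Lemma allnz_rot5 t : allnz (rot5 t) = allnz t.
Proof.
by case: t => [[[[t1 t2] t3] t4] t5]; rewrite /allnz /= [RHS]andbC -!andbA.
Qed.

(** If p1 = p2 = p3 = 0, then t2 = 0. *)
Lemma no_three_p (t : Z5) : let: (t1, t2, t3, t4, t5) := t in
  ~~ [&& allnz t, t3 + t4 == t1, t4 + t5 == t2 & t5 + t1 == t3].
Proof.
case: t => [[[[t1 t2] t3] t4] t5]; apply/negP.
case/and4P=> /and5P[_ h _ _ _] /eqP<- /eqP e2 /eqP e3.
case/negP: h; apply/eqP; rewrite -e2; apply: (addrI t3).
by rewrite addr0 -[in RHS]e3; ring.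
Qed.

Lemma incl_excl t : 1 - (Xgen t)%:R =
  orbit5 ie_t t + (t == (0, 0, 0, 0, 0))%:R + orbit5 ie_p t.
Proof.
rewrite /orbit5; have n1 := no_three_p t; have n2 := no_three_p (rot5 t).
have n3 := no_three_p (rot5 (rot5 t)); have n4 := no_three_p (rot5 (rot5 (rot5 t))).
have n5 := no_three_p (rot5 (rot5 (rot5 (rot5 t)))).
have s1 := allnz_rot5 t; have s2 := allnz_rot5 (rot5 t).
have s3 := allnz_rot5 (rot5 (rot5 t)).
have s4 := allnz_rot5 (rot5 (rot5 (rot5 t))).
rewrite s1 in s2; rewrite s2 in s3; rewrite s3 in s4.
move: n1 n2 n3 n4 n5 s1 s2 s3 s4.
case: t => [[[[t1 t2] t3] t4] t5]; rewrite /ie_t /ie_p /rot5.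
move=> n1 n2 n3 n4 n5 s1 s2 s3 s4.
rewrite s1 in n2 *; rewrite s2 in n3 *; rewrite s3 in n4 *; rewrite s4 in n5 *.
have hp := ie_cyclic5 n1 n2 n3 n4 n5.
have hz := ie_bool5 (t1 == 0) (t2 == 0) (t3 == 0) (t4 == 0) (t5 == 0).
rewrite /= in hz.
rewrite /Xgen -hp.
rewrite -[[&& t1 != 0, _, _, _ & _]]/(allnz (t1, t2, t3, t4, t5)) in hz.
have -> : ((t1, t2, t3, t4, t5) == (0,0,0,0,0) :> Z5) =
 [&& t1 == 0, t2 == 0, t3 == 0, t4 == 0 & t5 == 0] by rewrite !xpair_eqE -!andbA.
by rewrite -hz; ring.
Qed.

Lemma complement_incl_excl :
  \sum_(t : Z5) M05sum5 t - \sum_(t | Xgen t) M05sum5 t =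
  5 * \sum_t M05sum5 t * ie_t t + (q - 2) * (q - 3) + 5 * \sum_t M05sum5 t * ie_p t.
Proof.
rewrite -(sum_orbit ie_t) -(sum_orbit ie_p) -M05sum_0.
have -> : M05sum 0 0 0 0 0 = \sum_t M05sum5 t * (t == (0, 0, 0, 0, 0))%:R.
  by rewrite sum_delta.
rewrite -sum_ind -!big_split -sumrB /=; apply: eq_bigr => t _.
by rewrite -!mulrDr -incl_excl; ring.
Qed.

Lemma sum_ie_t : \sum_t M05sum5 t * ie_t t =
  (A ^+ 2 - K ^+ 2 * A) - (A * B - K * A)
  - (B ^+ 2 + (JJsum + (K - 1) * (K - 2) * q) - 4 * Jsum + 2 * K - 4 - K ^+ 2 * B)
  + (B ^+ 2 - A) + (B ^+ 2 - K * B) - (q - 3) * B.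
Proof.
rewrite -sum_z4 -sum_z34 -sum_z14 -sum_z345 -sum_z134 -sum_z1345 -!sum_ind.
rewrite -!(sumrB, big_split) /=; apply: eq_bigr => -[[[[t1 t2] t3] t4] t5] _.
by rewrite /ie_t; ring.
Qed.

(** * The sums with no t_i but some p_i equal to 0 *)

Lemma sum_neq0N b (f : Z -> algC) : b != 0 ->
  \sum_(a | (a != 0) && (a != - b)) f a = \sum_(a | a != 0) f a - f (- b).
Proof. by move=> b0; rewrite sum_neq2 1?eq_sym ?oppr_eq0 // sum_neq. Qed.

Lemma sum_sgn_neqr u : u != 0 ->
  \sum_(a | (a != 0) && (a != u)) sgn a = -1 - sgn u.
Proof. by move=> u0; rewrite sum_neq2 1?eq_sym // psiN1_sum0 sgn0 sub0r. Qed.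

(** Each nonzero d is a difference of nonzero elements in K - 2 ways, and 0 in
    K - 1 ways. *)
Lemma sum_sub_neq0 (g : Z -> algC) :
  \sum_(a | a != 0) \sum_(b | b != 0) g (a - b) = (K - 2) * \sum_a g a + g 0.
Proof.
have e a : \sum_(b | b != 0) g (a - b) = \sum_b g b - g a.
  by rewrite sum_neq subr0 [X in _ = X - _](reindex_inj (inv_inj (@subKr Z a))).
under eq_bigr => a _ do rewrite e.
by rewrite sumrB sum_const_neq sum_neq; ring.
Qed.

Lemma sum_shift2 (f : Z -> Z -> algC) :
  \sum_(a | a != 0) \sum_(b | (b != 0) && (b != - a)) f a (a + b) =
  \sum_(u | u != 0) \sum_(a | (a != 0) && (a != u)) f a u.
Proof.
rewrite !pair_big_dep /=.
apply: (eq_reindex (h := fun p => (p.2, p.1 - p.2)) (h' := fun p => (p.1 + p.2, p.1))).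
  move=> [a b] /= /and3P[a0 b0 ba]; split; last by congr (_, _); ring.
  rewrite a0 addrC addr_eq0 ba /= -subr_eq0.
  by rewrite (_ : a - (b + a) = - b) ?oppr_eq0 //; ring.
move=> [u a] /= /and3P[u0 a0 au]; split; [|by congr (_, _); ring|by congr f; ring].
by rewrite a0 subr_eq0 eq_sym au /= -addr_eq0 subrK.
Qed.

Lemma sum_neg2 (f : Z -> Z -> algC) :
  \sum_(a | a != 0) \sum_(b | (b != 0) && (b != - a)) f (- a) (- b) =
  \sum_(a | a != 0) \sum_(b | (b != 0) && (b != - a)) f a b.
Proof.
rewrite -[RHS]sum_negZ; apply: eq_bigr => a _.
rewrite [RHS](reindex_inj oppr_inj) /=; apply: eq_bigl => b.
by rewrite oppr_eq0 eqr_opp.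
Qed.

Lemma jac_add a b : sgn a * jac (- a) (a + b) = jac (- a) (- b).
Proof. by rewrite [RHS]jac_refll sgnN; congr (_ * jac _ _); ring. Qed.

Lemma sum_p2 : \sum_(t : Z5 | let: (t1, t2, t3, t4, t5) := t in
     allnz t && (t4 + t5 == t2)) M05sum5 t =
  (Jsum + 1) ^+ 2 - (JJsum + (K - 1) * (K - 2) * q - 2 * Jsum + K - 1)
  + 2 * (K - 2) * (Jsum + 2 - K) - Jsum.
Proof.
transitivity (\sum_(t4 | t4 != 0) \sum_(t5 | (t5 != 0) && (t5 != - t4))
    \sum_(t1 | t1 != 0) \sum_(t3 | t3 != 0) M05sum t1 (t4 + t5) t3 t4 t5).
  rewrite 3!pair_big_dep /=.
  apply: (eq_reindex
    (h := fun p => let: (t4, t5, t1, t3) := p in (t1, t4 + t5, t3, t4, t5))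
    (h' := fun t => let: (t1, t2, t3, t4, t5) := t in (t4, t5, t1, t3))).
    case=> [[[[t1 t2] t3] t4] t5] /andP[/and5P[t10 t20 t30 t40 t50] /eqP e] /=.
    by split; [rewrite t40 t50 t10 t30 !andbT -addr_eq0 addrC e | rewrite e].
  case=> [[[t4 t5] t1] t3] /= /andP[/andP[/and3P[t40 t50 t54] t10] t30].
  by split=> //=; rewrite t10 t30 t40 t50 addrC addr_eq0 t54 eqxx.
pose P t := jacgen t - sgn t.
have sP : \sum_(t | t != 0) P t = Jsum + 1.
  by rewrite sumrB sum_jacgen sum_sgn_neq opprK.
have sPP : \sum_(t | t != 0) P t * P (- t) =
    JJsum + (K - 1) * (K - 2) * q - 2 * Jsum + K - 1.
  transitivity (\sum_(t | t != 0)
      (jacgen t * jacgen (- t) - jacgen t - jacgen (- t) + 1)).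
    apply: eq_bigr => t _; rewrite /P sgnN.
    have h1 := sgn_jacgen t; have h2 := sgn_jacgen (- t); rewrite sgnN in h2.
    have -> : (jacgen t - sgn t) * (jacgen (- t) - sgn t) = jacgen t * jacgen (- t)
      - sgn t * jacgen t - sgn t * jacgen (- t) + sgn t * sgn t by ring.
    by rewrite h1 h2 sgn_sq.
  rewrite !big_split /= !sumrN (sum_negZ jacgen) sum_jacgen sum_jacgen_opp.
  rewrite sum_const_neq.
  ring.
transitivity (\sum_(t4 | t4 != 0) \sum_(t5 | (t5 != 0) && (t5 != - t4))
   (P t4 * P t5 - (K - 2) * (sgn t4 * jacrow (t4 + t5)) - jac (- t4) (- t5))).
  apply: eq_bigr => t4 t40; apply: eq_bigr => t5 /andP[t50 _].
  rewrite -jac_add /P -!sum_jac_neq0 //.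
  transitivity (\sum_(t1 | t1 != 0) (jac t1 t5 * (\sum_(s | s != 0) jac s t4))
    - sgn t4 * \sum_(t1 | t1 != 0) \sum_(t3 | t3 != 0) jac (t1 - t3 - t4) (t4 + t5)).
    rewrite mulr_sumr -sumrB; apply: eq_bigr => t1 _.
    rewrite !mulr_sumr -sumrB; apply: eq_bigr => t3 _; exact: M05sum_p2.
  rewrite -mulr_suml (sum_sub_neq0 (fun d => jac (d - t4) (t4 + t5))).
  by rewrite sum_jac_shift sub0r; ring.
under eq_bigr => t4 _ do rewrite !sumrB.
rewrite !sumrB (sum_neg2 jac) -/Jsum.
rewrite (sum_shift2 (fun a u => (K - 2) * (sgn a * jacrow u))).
have -> : \sum_(t | t != 0) \sum_(b | (b != 0) && (b != - t)) P t * P b =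
   (Jsum + 1) ^+ 2 - (JJsum + (K - 1) * (K - 2) * q - 2 * Jsum + K - 1).
  under eq_bigr => t t0 do rewrite -mulr_sumr sum_neq0N // sP mulrBr.
  by rewrite sumrB -mulr_suml sP sPP.
under [X in _ - X - _]eq_bigr => u _ do rewrite -mulr_sumr.
rewrite -mulr_sumr.
have -> : \sum_(u | u != 0) \sum_(a | (a != 0) && (a != u)) sgn a * jacrow u =
  - (2 * (Jsum + 2 - K)).
  transitivity (\sum_(u | u != 0) (2 + 2 * sgn u - 2 * jacgen u)).
    apply: eq_bigr => u u0; rewrite -mulr_suml sum_sgn_neqr // jacrow_gen //.
    have -> : (-1 - sgn u) * (jacgen u - 1 - sgn u) =
      - jacgen u + 1 + 2 * sgn u - sgn u * jacgen u + sgn u * sgn u by ring.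
    by rewrite sgn_jacgen sgn_sq; ring.
  rewrite sumrB big_split -!mulr_sumr /= sum_jacgen sum_sgn_neq sum_const_neq; ring.
ring.
Qed.

(** The terms with t3 + t4 + t5 = 0 have a degenerate first factor and give the
    twisted sum; the substitution s = - t3 - t4, t = t3, v = - t3 - t4 - t5 turns
    the others into S^-_k. *)
Lemma sum_p12 : \sum_(t : Z5 | let: (t1, t2, t3, t4, t5) := t in
     [&& allnz t, t3 + t4 == t1 & t4 + t5 == t2]) M05sum5 t =
  JJsum_sgn - Jsum_sgn - (K - 2) ^+ 2.
Proof.
transitivity (\sum_(t3 | t3 != 0) \sum_(t4 | (t4 != 0) && (t4 != - t3))
    \sum_(t5 | (t5 != 0) && (t5 != - t4)) M05sum (t3 + t4) (t4 + t5) t3 t4 t5).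
  rewrite 2!pair_big_dep /=.
  apply: (eq_reindex
    (h := fun p => let: (t3, t4, t5) := p in (t3 + t4, t4 + t5, t3, t4, t5))
    (h' := fun t => let: (t1, t2, t3, t4, t5) := t in (t3, t4, t5))).
    case=> [[[[t1 t2] t3] t4] t5].
    case/and3P=> /and5P[t10 t20 t30 t40 t50] /eqP e1 /eqP e2 /=.
    split; last by rewrite e1 e2.
    by rewrite t30 t40 t50 -addr_eq0 addrC e1 t10 -addr_eq0 addrC e2.
  case=> [[t3 t4] t5] /= /andP[/and3P[t30 t40 t43] /andP[t50 t54]].
  split=> //=; rewrite t30 t40 t50 !eqxx.
  by rewrite addrC addr_eq0 t43 addrC addr_eq0 t54.
transitivity (\sum_(t3 | t3 != 0) \sum_(t4 | (t4 != 0) && (t4 != - t3))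
    (\sum_(t5 | [&& t5 != 0, t5 != - t4 & t5 != - (t3 + t4)])
       (jac (t3 + t4) t5 * jac t3 t4)
     - sgn (t3 + t4) * jac t3 t4 + (K - 2) * sgn t4)).
  apply: eq_bigr => t3 t30; apply: eq_bigr => t4 /andP[t40 t43].
  have t340 : t3 + t4 != 0 by rewrite addrC addr_eq0.
  transitivity (\sum_(t5 | (t5 != 0) && (t5 != - t4))
      (jac (t3 + t4) t5 * jac t3 t4 + sgn t4)).
    apply: eq_bigr => t5 /andP[t50 t54]; rewrite M05sum_p2.
    have -> : t3 + t4 - t3 - t4 = 0 by ring.
    by rewrite jac0l ?mulrN1 ?opprK // addrC addr_eq0.
  rewrite big_split /= sum_const_neq2 //; congr (_ + _).
  rewrite (bigD1 (- (t3 + t4))) /=; last first.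
    by rewrite oppr_eq0 t340 eqr_opp -subr_eq0 addrK.
  rewrite jacN // addrC mulNr; congr (_ + _).
  by apply: eq_bigl => t5; rewrite -andbA.
under eq_bigr => t3 t30 do
  rewrite big_split sumrB -mulr_sumr /= sum_sgn_neq2 //.
rewrite big_split sumrB -/Jsum_sgn -mulr_sumr /= sumrB sum_sgn_neq sum_const_neq.
have -> : (K - 2) * ((K - 1) * -1 - -1) = - (K - 2) ^+ 2 by ring.
congr (_ - _ - _); rewrite /JJsum_sgn 4!pair_big_dep /=.
apply: (eq_reindex
    (h := fun p => let: (s, t, v) := p in (t, - s - t, s - v))
    (h' := fun p => let: (t3, t4, t5) := p in (- t3 - t4, t3, - t3 - t4 - t5))).
  case=> [[t3 t4] t5] /= /andP[/and3P[t30 t40 t43] /and3P[t50 t54 t543]].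
  split; last by congr (_, _, _); ring.
  rewrite -opprD oppr_eq0 addrC addr_eq0 t43 t30 /= opprK addrC.
  rewrite -[t3 == _]subr_eq0.
  apply/and4P; split.
  - by rewrite [X in X != 0](_ : _ = - t4) ?oppr_eq0 //; ring.
  - by rewrite -opprD oppr_eq0 [_ + t5]addrC addr_eq0.
  - by rewrite -subr_eq0 [X in X != 0](_ : _ = - t5) ?oppr_eq0 //; ring.
  rewrite -subr_eq0 [X in X != 0](_ : _ = - (t5 + t4)); last by ring.
  by rewrite oppr_eq0 addr_eq0.
case=> [[s t] v] /= /andP[/and3P[s0 t0 ts] /and3P[v0 vs vt]].
split; [|by congr (_, _, _); ring|].
  rewrite t0 /= -!andbA; apply/and5P; split.
  - by rewrite -opprD oppr_eq0 addrC addr_eq0.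
  - by rewrite -subr_eq0 [X in X != 0](_ : _ = - s) ?oppr_eq0 //; ring.
  - by rewrite subr_eq0 eq_sym.
  - rewrite -subr_eq0 [X in X != 0](_ : _ = - (v + t)); last by ring.
    by rewrite oppr_eq0 addr_eq0.
  by rewrite -subr_eq0 [X in X != 0](_ : _ = - v) ?oppr_eq0 //; ring.
(* Reflecting both factors produces the sign of s + t. *)
have -> : t + (- s - t) = - s by ring.
rewrite (jac_refll (- s) v) (jac_sym s) (jac_refll t s) sgnN sgnD.
have -> : jac t (- t - s) = jac t (- s - t) by congr jac; ring.
have -> : jac (- s) (- - s - v) = jac (- s) (s - v) by congr jac; ring.
transitivity ((sgn s * sgn s) * (sgn t * sgn t) *
    (jac (- s) (s - v) * jac t (- s - t))).
  by rewrite !sgn_sq !mul1r.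
ring.
Qed.

Lemma sum_p24 : \sum_(t : Z5 | let: (t1, t2, t3, t4, t5) := t in
     [&& allnz t, t4 + t5 == t2 & t1 + t2 == t4]) M05sum5 t = 4 * Jsum + 4 - 2 * K.
Proof.
transitivity (\sum_(t4 | t4 != 0) \sum_(t5 | (t5 != 0) && (t5 != - t4))
    \sum_(t3 | t3 != 0) M05sum (- t5) (t4 + t5) t3 t4 t5).
  rewrite 2!pair_big_dep /=.
  apply: (eq_reindex
    (h := fun p => let: (t4, t5, t3) := p in (- t5, t4 + t5, t3, t4, t5))
    (h' := fun t => let: (t1, t2, t3, t4, t5) := t in (t4, t5, t3))).
    case=> [[[[t1 t2] t3] t4] t5].
    case/and3P=> /and5P[t10 t20 t30 t40 t50] /eqP e2 /eqP e4 /=.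
    split; first by rewrite t30 t40 t50 -addr_eq0 addrC e2 t20.
    by rewrite e2; congr (_, _, _, _, _); apply: (addIr t2); rewrite e4 -e2; ring.
  case=> [[t4 t5] t3] /= /andP[/and3P[t40 t50 t54] t30].
  split=> //=; rewrite t30 t40 t50 oppr_eq0 t50 eqxx addrC addr_eq0 t54 /=.
  by apply/eqP; ring.
transitivity (\sum_(t4 | t4 != 0) \sum_(t5 | (t5 != 0) && (t5 != - t4))
    (sgn t5 * - (jacgen t4 - sgn t4) - sgn t4 * (jacrow (t4 + t5) + sgn (t4 + t5)))).
  apply: eq_bigr => t4 t40; apply: eq_bigr => t5 /andP[t50 t54].
  have u0 : t4 + t5 != 0 by rewrite addrC addr_eq0.
  transitivity (\sum_(t3 | t3 != 0)
     (- sgn t5 * jac t3 t4 - sgn t4 * jac (- (t4 + t5) - t3) (t4 + t5))).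
    apply: eq_bigr => t3 _; rewrite M05sum_p2 (jac_sym _ t5) jacN //.
    by congr (_ - _ * jac _ _); ring.
  rewrite sumrB -!mulr_sumr sum_jac_neq0 //.
  rewrite sum_neq sum_jac_refl subr0 (jac_sym _ (t4 + t5)) jacN // opprK.
  by ring.
under eq_bigr => t4 t40 do rewrite sumrB -mulr_suml sum_sgn_neq2 //.
rewrite sumrB (sum_shift2 (fun a u => sgn a * (jacrow u + sgn u))).
rewrite -sumrB.
transitivity (\sum_(t | t != 0) (4 * jacgen t - 2 * sgn t - 2)); last first.
  rewrite !sumrB -!mulr_sumr sum_jacgen sum_sgn_neq sum_const_neq; ring.
apply: eq_bigr => t t0; rewrite -mulr_suml sum_sgn_neqr // jacrow_gen //.
have -> : (-1 - sgn t) * - (jacgen t - sgn t)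
   - (-1 - sgn t) * (jacgen t - 1 - sgn t + sgn t)
   = 2 * jacgen t + 2 * (sgn t * jacgen t) - 2 * sgn t - sgn t * sgn t - 1 by ring.
by rewrite sgn_jacgen sgn_sq; ring.
Qed.

Lemma sum_p134 : \sum_(t : Z5 | let: (t1, t2, t3, t4, t5) := t in
     [&& allnz t, t3 + t4 == t1, t5 + t1 == t3 & t1 + t2 == t4]) M05sum5 t =
  - (K - 2) - Jsum_sgn.
Proof.
transitivity (\sum_(t3 | t3 != 0) \sum_(t4 | (t4 != 0) && (t4 != - t3))
    M05sum (t3 + t4) (- t3) t3 t4 (- t4)).
  rewrite pair_big_dep /=.
  apply: (eq_reindex
    (h := fun p => let: (t3, t4) := p in (t3 + t4, - t3, t3, t4, - t4))
    (h' := fun t => let: (t1, t2, t3, t4, t5) := t in (t3, t4))).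
    case=> [[[[t1 t2] t3] t4] t5].
    case/and4P=> /and5P[t10 t20 t30 t40 t50] /eqP e1 /eqP e3 /eqP e4 /=.
    split; first by rewrite t30 t40 -addr_eq0 addrC e1 t10.
    congr (_, _, _, _, _) => //.
      by apply: (addrI t1); rewrite e4 -e1; ring.
    by apply: (addIr t1); rewrite e3 -e1; ring.
  case=> [t3 t4] /= /and3P[t30 t40 t43].
  split=> //=; rewrite t30 t40 !oppr_eq0 t30 t40 eqxx addrC addr_eq0 t43 /=.
  by apply/andP; split; apply/eqP; ring.
transitivity (\sum_(t3 | t3 != 0) \sum_(t4 | (t4 != 0) && (t4 != - t3))
    (sgn t3 * sgn t4 - sgn (- t3 + - t4) * jac (- t3) (- t4))).
  apply: eq_bigr => t3 t30; apply: eq_bigr => t4 /andP[t40 t43].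
  rewrite M05sum_p1 (jac_sym (- t4) t4) (jac_sym (- t3) t3) !jacN // sgnD !sgnN.
  have -> : - t4 - - t3 - t3 = - t4 by ring.
  rewrite [t3 + t4]addrC -[jac (- t4) _]mul1r -(sgn_sq t4).
  by rewrite -[_ * _ * jac _ _]mulrA jac_add (jac_sym (- t3)); ring.
under eq_bigr => t3 t30 do rewrite sumrB -mulr_sumr sum_sgn_neq2 // mulrBr sgn_sq.
rewrite !sumrB (sum_neg2 (fun a b => sgn (a + b) * jac a b)) -/Jsum_sgn.
by rewrite -mulr_suml sum_sgn_neq sum_const_neq; ring.
Qed.

Lemma sum_ie_p : \sum_t M05sum5 t * ie_p t =
  ((Jsum + 1) ^+ 2 - (JJsum + (K - 1) * (K - 2) * q - 2 * Jsum + K - 1)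
  + 2 * (K - 2) * (Jsum + 2 - K) - Jsum) - (JJsum_sgn - Jsum_sgn - (K - 2) ^+ 2)
  - (4 * Jsum + 4 - 2 * K) + (- (K - 2) - Jsum_sgn).
Proof.
rewrite -sum_p2 -sum_p12 -sum_p24 -sum_p134 -!sum_ind.
rewrite -!(sumrB, big_split) /=; apply: eq_bigr => -[[[[t1 t2] t3] t4] t5] _.
by rewrite /ie_p; ring.
Qed.

(** The sum of M over the t outside the generic set, in closed form. *)
Lemma sum_M05sum_complement :
  \sum_(t : Z5) M05sum5 t = 10 * Jsum ^+ 2 + 5 * (q - K ^+ 2 + 1) * Jsum - 10 * JJsum
    - 5 * JJsum_sgn + q ^+ 2 - 10 * (K - 1) ^+ 2 * q + 5 * K ^+ 2 * (K - 1) + 1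
    + \sum_(t : Z5 | Xgen t) M05sum5 t.
Proof.
by apply/eqP; rewrite -subr_eq complement_incl_excl sum_ie_t sum_ie_p; apply/eqP; ring.
Qed.

End PowerCharacters.

(** * Transitive subtournaments and ordered paths *)

(** A list whose elements are related in order by an asymmetric relation is
    determined by the set of its elements. *)
Lemma pairwise_inj (V : eqType) (e : rel V) (s1 s2 : seq V) :
    (forall x y, e x y -> ~~ e y x) ->
  pairwise e s1 -> pairwise e s2 -> s1 =i s2 -> s1 = s2.
Proof.
move=> asym; have irr x : ~~ e x x
  by apply/negP => exx; move: (asym _ _ exx); rewrite exx.
elim: s1 s2 => [|x s1 IHs] [|y s2] //=.
- by move=> _ _ /(_ y); rewrite !inE eqxx.
- by move=> _ _ /(_ x); rewrite !inE eqxx.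
case/andP=> /allP e1 p1 /andP[/allP e2 p2] s12.
have xy : x = y.
  apply/eqP/negPn/negP => xy.
  have x2 : x \in s2 by move: (s12 x); rewrite !inE eqxx (negPf xy).
  have y1 : y \in s1 by move: (s12 y); rewrite !inE eqxx eq_sym (negPf xy).
  by have := asym _ _ (e1 _ y1); rewrite e2.
rewrite -xy in e2 s12 *; congr (_ :: _); apply: IHs => // z.
have := s12 z; rewrite !inE; case: (eqVneq z x) => //= -> _.
have /negPf-> : x \notin s1 by apply/negP => /e1; apply/negP.
by have /negPf-> : x \notin s2 by apply/negP => /e2; apply/negP.
Qed.

(** A transitive subtournament of an asymmetric digraph is determined by the
    unique ordering of its vertices. *)
Lemma num_transitive_subtournamentsE (V : finType) (e : rel V) (m : nat) :
    (forall x y, e x y -> ~~ e y x) ->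
  num_transitive_subtournaments m e = #|[set a : m.-tuple V | pairwise e a]|.
Proof.
move=> asym; have irr x : ~~ e x x
  by apply/negP => exx; move: (asym _ _ exx); rewrite exx.
pose edges (a : m.-tuple V) := [set p : V * V |
  [exists i : 'I_m, exists j : 'I_m, (i < j)%N && (p == (tnth a i, tnth a j))]].
have edgesP (a : m.-tuple V) p : reflect (exists i j : 'I_m, (i < j)%N /\
    p = (tnth a i, tnth a j)) (p \in edges a).
  rewrite inE.
  apply: (iffP existsP) => [[i /existsP[j /andP[ij /eqP->]]]|[i [j [ij ->]]]].
    by exists i, j.
  by exists i; apply/existsP; exists j; rewrite ij eqxx.
have pwP (a : m.-tuple V) : reflect
    (forall i j : 'I_m, (i < j)%N -> e (tnth a i) (tnth a j)) (pairwise e a).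
  case: m a {edges edgesP} => [|m] a; first by rewrite tuple0; apply: ReflectT => -[].
  have x0 : V := tnth a ord0.
  apply: (iffP (pairwiseP x0)) => h i j.
    by move=> ij; rewrite !(tnth_nth x0); apply: h; rewrite ?inE ?size_tuple.
  rewrite !inE !size_tuple => im jm ij.
  by have := h (Ordinal im) (Ordinal jm) ij; rewrite !(tnth_nth x0).
have pw_inj (a : m.-tuple V) : pairwise e a -> injective (tnth a).
  move/pwP=> h i j eij; case: (ltngtP i j) => [/h|/h|/val_inj//].
    by rewrite eij (negPf (irr _)).
  by rewrite eij (negPf (irr _)).
pose f (a : m.-tuple V) := ([set x in a], edges a).
rewrite /num_transitive_subtournaments -(card_in_imset (f := f)); last first.
  move=> a b; rewrite !inE => pa pb [/setP eab _]; apply/val_inj.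
  by apply: (pairwise_inj asym pa pb) => x; have := eab x; rewrite !inE.
apply: eq_card => -[A E]; rewrite inE /=; apply/and4P/imsetP; last first.
  case=> a; rewrite inE => pa [-> ->]; have inj := pw_inj a pa; have /pwP ha := pa.
  split.
  - rewrite cardsE; move/card_uniqP: (introT (tuple_uniqP a) inj) => ->.
    by rewrite size_tuple.
  - apply/andP; split.
      apply/forallP => p; apply/implyP => /edgesP[i [j [ij ->]]] /=.
      rewrite !inE !mem_tnth /=; apply: contraTneq (ha _ _ ij) => ->; exact: irr.
    apply/forallP => x; apply/implyP; rewrite inE => /tnthP[i ->].
    apply/forallP => y; apply/implyP; rewrite inE => /tnthP[j ->].
    apply/implyP => ij; have eP (u v : 'I_m) :
        ((tnth a u, tnth a v) \in edges a) = (u < v)%N.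
      apply/edgesP/idP => [[u' [v' [uv []]]]|uv]; last by exists u, v.
      by move=> /inj -> /inj ->.
    rewrite !eP; case: ltngtP => // /val_inj eij.
    by rewrite eij eqxx in ij.
  - apply/existsP; exists a; rewrite eqxx; apply/forallP => i; apply/forallP => j.
    by apply/implyP => ij; apply/edgesP; exists i, j.
  by apply/forallP => p; apply/implyP => /edgesP[i [j [ij ->]]]; apply: ha.
case=> _ /andP[/forallP tE /forallP tA].
case/existsP=> a /andP[/eqP defA /forallP ha] /forallP eE.
have aE (i j : 'I_m) : (i < j)%N -> (tnth a i, tnth a j) \in E.
  by move=> ij; have /forallP/(_ j)/implyP/(_ ij) := ha i.
exists a.
  rewrite inE; apply/pwP => i j ij.
  by have /implyP/(_ (aE _ _ ij)) := eE (tnth a i, tnth a j).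
congr (_, _) => //; apply/setP => -[x y]; apply/idP/edgesP => [xyE|[i [j [ij ->]]]].
  have /implyP/(_ xyE)/and3P[/= Ax Ay xy] := tE (x, y).
  have /implyP/(_ Ax)/forallP/(_ y)/implyP/(_ Ay)/implyP/(_ xy) := tA x.
  rewrite xyE /= => yxE; move: Ax Ay xy xyE yxE; rewrite defA !inE.
  move=> /tnthP[i ->] /tnthP[j ->] ij xyE yxE; exists i, j; split=> //.
  case: (ltngtP i j) => // [/aE|/val_inj eij]; first by rewrite (negPf yxE).
  by rewrite eij eqxx in ij.
exact: aE.
Qed.

(** * Multiplicative characters and the hypergeometric function *)

Section MultiplicativeCharacters.
Variable F : finFieldType.
Implicit Types (A B : unit_cfun F) (x y : F).
Local Notation q := (#|F|%:R : algC).

Lemma unit_val x : x != 0 -> exists u : {unit F}, val u = x.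
Proof.
by rewrite -unitfE => ux; exists (Sub x ux); rewrite SubK.
Qed.

Lemma mulchar0 A : mulchar_ext A 0 = 0.
Proof. by rewrite /mulchar_ext insubN ?unitr0. Qed.

Lemma mulchar_val A (u : {unit F}) : mulchar_ext A (val u) = A u.
Proof. by rewrite /mulchar_ext valK. Qed.

Lemma mulchar_mull A B x : mulchar_ext (A * B) x = mulchar_ext A x * mulchar_ext B x.
Proof.
have [->|/unit_val[u <-]] := eqVneq x 0; first by rewrite !mulchar0 mul0r.
by rewrite !mulchar_val cfunE.
Qed.

Lemma mulchar_exp A n x : x != 0 -> mulchar_ext (A ^+ n) x = mulchar_ext A x ^+ n.
Proof. by move=> /unit_val[u <-]; rewrite !mulchar_val exp_cfunE ?inE. Qed.

Lemma mulchar_1l x : x != 0 -> mulchar_ext 1 x = 1.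
Proof. by move=> /unit_val[u <-]; rewrite mulchar_val cfun1E inE. Qed.

Lemma mulchar_1r A : A \is a linear_char -> mulchar_ext A 1 = 1.
Proof. by move=> lA; rewrite -FinRing.val_unit1 mulchar_val lin_char1. Qed.

Lemma mulcharM A x y : A \is a linear_char ->
  mulchar_ext A (x * y) = mulchar_ext A x * mulchar_ext A y.
Proof.
move=> lA; have [->|/unit_val[u <-]] := eqVneq x 0; first by rewrite !(mul0r, mulchar0).
have [->|/unit_val[v <-]] := eqVneq y 0; first by rewrite !(mulr0, mulchar0).
by rewrite -FinRing.val_unitM !mulchar_val lin_charM ?inE.
Qed.

Lemma mulchar_neq0 A x : A \is a linear_char -> x != 0 -> mulchar_ext A x != 0.
Proof. by move=> lA /unit_val[u <-]; rewrite mulchar_val lin_char_neq0 ?inE. Qed.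

Lemma mulcharV A x : A \is a linear_char ->
  mulchar_ext A x^-1 = (mulchar_ext A x)^-1.
Proof.
move=> lA; have [->|x0] := eqVneq x 0; first by rewrite invr0 mulchar0 invr0.
apply: (mulfI (mulchar_neq0 lA x0)).
by rewrite -mulcharM // !mulfV ?mulchar_neq0 ?mulchar_1r.
Qed.

Lemma mulchar_inv A x : A \is a linear_char ->
  mulchar_ext A^-1 x = (mulchar_ext A x)^-1.
Proof.
move=> lA; have [->|x0] := eqVneq x 0; first by rewrite !mulchar0 invr0.
apply: (mulfI (mulchar_neq0 lA x0)).
by rewrite -mulchar_mull mulrV ?lin_char_unitr // mulchar_1l // mulfV ?mulchar_neq0.
Qed.

Lemma irr_lin (i : Iirr [set: {unit F}]) : 'chi_i \is a linear_char.
Proof. exact/char_abelianP/cyclic_abelian/field_unit_group_cyclic. Qed.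

(** Column orthogonality: the irreducible characters of the abelian group of
    units add up to its regular character. *)
Lemma sum_irr w :
  \sum_i mulchar_ext ('chi[[set: {unit F}]]_i) w = (q - 1) * (w == 1)%:R.
Proof.
have [->|/unit_val[u <-]] := eqVneq w 0.
  by rewrite [0 == 1]eq_sym oner_eq0 mulr0 big1 // => i _; rewrite mulchar0.
have := cfRegE [set: {unit F}] u; rewrite cfReg_sum sum_cfunE.
under eq_bigr => i _ do rewrite cfunE lin_char1 ?irr_lin // mul1r -mulchar_val.
move=> ->; rewrite card_finField_unit -mulr_natr -subn1 natrB; last first.
  exact/ltnW/finNzRing_gt1.
by rewrite -(inj_eq val_inj) FinRing.val_unit1.
Qed.
(** [C] enters this binomial coefficient only through its values at the
    - x / (1 - x). *)
Lemma greene_binom_mul A B C :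
    A \is a linear_char -> B \is a linear_char -> C \is a linear_char ->
  q * greene_binom (A * C) (B * C) = mulchar_ext B (-1) *
    \sum_x mulchar_ext A x / mulchar_ext B (1 - x) * mulchar_ext C (- (x / (1 - x))).
Proof.
move=> lA lB lC; have q0 : q != 0.
  by rewrite pnatr_eq0 -lt0n (ltn_trans _ (finNzRing_gt1 F)).
rewrite /greene_binom mulrA [X in X * _]mulrC divfK // /jacobi.
rewrite mulchar_mull -mulrA; congr (_ * _); rewrite mulr_sumr.
apply: eq_bigr => x _; rewrite mulchar_inv ?rpredM // !mulchar_mull.
rewrite -[- (x / _)]mulN1r !mulcharM // mulcharV // invfM; ring.
Qed.

(** By [sum_irr] the sum over all characters leaves only the (x, y, z) for
    which the product of - x / (1 - x), - y / (1 - y) and - z / (1 - z) is 1. *)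
Lemma greene_3F2_at1 A0 A1 A2 B1 B2 :
    A0 \is a linear_char -> A1 \is a linear_char -> A2 \is a linear_char ->
    B1 \is a linear_char -> B2 \is a linear_char ->
  q ^+ 2 * greene_hypergeometric [tuple A0; A1; A2] [tuple B1; B2] 1 =
  mulchar_ext B1 (-1) * mulchar_ext B2 (-1) *
  \sum_(p : F * F * F | - (p.1.1 / (1 - p.1.1)) * - (p.1.2 / (1 - p.1.2))
                          * - (p.2 / (1 - p.2)) == 1)
    mulchar_ext A0 p.1.1 * (mulchar_ext A1 p.1.2 / mulchar_ext B1 (1 - p.1.2))
     * (mulchar_ext A2 p.2 / mulchar_ext B2 (1 - p.2)).
Proof.
move=> lA0 lA1 lA2 lB1 lB2.
have q0 : q != 0.
  by rewrite pnatr_eq0 -lt0n (ltn_trans _ (finNzRing_gt1 F)).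
have q1 : q - 1 != 0.
  by rewrite subr_eq0 pnatr_eq1 gtn_eqF // finNzRing_gt1.
pose w (p : F * F * F) := - (p.1.1 / (1 - p.1.1)) * - (p.1.2 / (1 - p.1.2))
   * - (p.2 / (1 - p.2)).
pose f (p : F * F * F) := mulchar_ext A0 p.1.1 *
    (mulchar_ext A1 p.1.2 / mulchar_ext B1 (1 - p.1.2))
     * (mulchar_ext A2 p.2 / mulchar_ext B2 (1 - p.2)).
rewrite -[RHS](mulKf q1) /greene_hypergeometric.
rewrite [LHS](_ : _ = (q - 1)^-1 * \sum_i q ^+ 3 *
   ((greene_binom (A0 * 'chi_i) 'chi_i * (greene_binom (A1 * 'chi_i) (B1 * 'chi_i) *
    greene_binom (A2 * 'chi_i) (B2 * 'chi_i))))); last first.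
  rewrite -mulr_sumr !mulrA; congr (_ * _); first by field.
  apply: eq_bigr => i _; rewrite mulchar_1r ?irr_lin // mulr1 !big_ord_recl big_ord0.
  by rewrite mulr1.
congr (_ * _).
transitivity (\sum_i mulchar_ext B1 (-1) * mulchar_ext B2 (-1) *
  \sum_p f p * mulchar_ext ('chi[[set: {unit F}]]_i) (w p)).
  apply: eq_bigr => i _; have li := irr_lin i.
  have l1 : (1 : unit_cfun F) \is a linear_char by exact: cfun1_lin_char.
  have := greene_binom_mul lA0 l1 li; rewrite mul1r => e0.
  have e1 := greene_binom_mul lA1 lB1 li; have e2 := greene_binom_mul lA2 lB2 li.
  rewrite (_ : q ^+ 3 * _ = (q * greene_binom (A0 * 'chi_i) 'chi_i) *
     (q * greene_binom (A1 * 'chi_i) (B1 * 'chi_i)) *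
     (q * greene_binom (A2 * 'chi_i) (B2 * 'chi_i))); last by ring.
  rewrite e0 e1 e2 mulchar_1l ?oppr_eq0 ?oner_eq0 // mul1r.
  rewrite [LHS](_ : _ = mulchar_ext B1 (-1) * mulchar_ext B2 (-1) *
    ((\sum_x mulchar_ext A0 x / mulchar_ext 1 (1 - x) *
         mulchar_ext 'chi_i (- (x / (1 - x)))) *
     (\sum_x mulchar_ext A1 x / mulchar_ext B1 (1 - x) *
         mulchar_ext 'chi_i (- (x / (1 - x)))) *
     (\sum_x mulchar_ext A2 x / mulchar_ext B2 (1 - x) *
         mulchar_ext 'chi_i (- (x / (1 - x)))))); last by ring.
  congr (_ * _); rewrite big_distrlr /= pair_bigA big_distrlr /= pair_bigA /=.
  apply: eq_bigr => -[[x y] z] _; rewrite /f /w /= !mulcharM //.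
  have [->|x1] := eqVneq (1 - x) 0.
    by rewrite invr0 mulr0 oppr0 !mulchar0 !(mul0r, mulr0).
  by rewrite mulchar_1l // invr1; ring.
rewrite -mulr_sumr mulrCA; congr (_ * _).
rewrite exchange_big /= mulr_sumr [RHS]big_mkcond; apply: eq_bigr => p _.
rewrite -mulr_sumr sum_irr -/(w p) -/(f p).
by case: (w p == 1); rewrite /=; ring.
Qed.

End MultiplicativeCharacters.

(** * The character of order k *)

Section OrderK.
Variables (F : finFieldType) (k : nat) (chi : unit_cfun F).
Hypotheses (k_ge2 : (2 <= k)%N) (k_even : ~~ odd k)
  (q_mod : (#|F| = k + 1 %[mod 2 * k])%N)
  (chi_char : chi \is a linear_char) (chi_order : #[chi]%CF = k).
Local Notation q := (#|F|%:R : algC).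

(** chi^a for an exponent [a] modulo k. *)
Definition powchar (a : 'Z_k) (x : F) : algC := mulchar_ext (chi ^+ a) x.

Lemma card_field_odd_mul : exists2 m, odd m & #|F| = (k * m).+1.
Proof.
exists (2 * (#|F| %/ (2 * k)) + 1)%N; first by rewrite oddD mul2n odd_double.
have := divn_eq #|F| (2 * k); rewrite q_mod modn_small; last by lia.
move=> {1}->; lia.
Qed.

Lemma oppr1_neq1 : (-1 : F) != 1.
Proof.
have [m _ qm] := card_field_odd_mul.
have d2 : (2 %| #|[set: {unit F}]|)%N.
  by rewrite card_finField_unit qm /= dvdn_mulr // dvdn2.
(* An element of order 2 is a square root of 1 other than 1, hence -1. *)
have [u _ ou] := Cauchy (isT : prime 2) d2.
have u1 : val u != 1.
  by rewrite -FinRing.val_unit1 (inj_eq val_inj) -order_eq1 ou.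
have : val u ^+ 2 == 1.
  by rewrite -FinRing.val_unitX -ou expg_order FinRing.val_unit1.
rewrite sqrf_eq1 (negPf u1) /= => /eqP <-; exact: u1.
Qed.

(** The units form a cyclic group <g>; if chi(g^n) = 1, then chi^n is trivial,
    so k divides n. *)
Lemma kth_powersE x : x != 0 -> (x \in kth_powers F k) = (mulchar_ext chi x == 1).
Proof.
move=> x0; rewrite inE; apply/existsP/eqP => [[y /andP[y0 /eqP->]]|].
  have -> : mulchar_ext chi (y ^+ k) = mulchar_ext (chi ^+ k) y.
    by have [u <-] := unit_val y0;
      rewrite -FinRing.val_unitX !mulchar_val lin_charX ?exp_cfunE ?inE.
  by rewrite -chi_order exp_cforder mulchar_1l.
have /cyclicP[g defG] := field_unit_group_cyclic [set: {unit F}].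
have gP v : exists n, v = (g ^+ n)%g by apply/cycleP; rewrite -defG inE.
have [u <-] := unit_val x0; have [n ->] := gP u; rewrite mulchar_val.
rewrite lin_charX ?inE // => gn1.
have : (k %| n)%N.
  rewrite -chi_order dvdn_cforder; apply/eqP/cfunP => v; have [i ->] := gP v.
  rewrite exp_cfunE ?inE // lin_charX ?inE // exprAC gn1 expr1n.
  by rewrite cfun1E inE.
case/dvdnP=> j ->; exists (val (g ^+ j)%g).
rewrite -unitfE (valP (g ^+ j)%g) /= -FinRing.val_unitX -expgM; exact: eqxx.
Qed.

Lemma zero_notin_kth_powers : 0 \notin kth_powers F k.
Proof.
rewrite inE; apply/existsP => -[y /andP[y0 /eqP e]].
by case/eqP: (expf_neq0 k y0).
Qed.

(** The exponent m = (q - 1) / k is odd, so -1 = y^k would give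
    -1 = (-1)^m = y^(q - 1) = 1. *)
Lemma opp1_notin_kth_powers : -1 \notin kth_powers F k.
Proof.
have [m m_odd qm] := card_field_odd_mul.
rewrite inE; apply/existsP => -[y /andP[y0 /eqP e]].
case/eqP: oppr1_neq1; transitivity ((-1 : F) ^+ m).
  by rewrite -signr_odd m_odd expr1.
have := expf_card y; rewrite qm exprS => /(canRL (mulKf y0)).
by rewrite mulVf // e -exprM.
Qed.

Lemma card_Zk : #|'Z_k| = k.
Proof. by rewrite card_ord Zp_cast. Qed.

Lemma ltn_Zk (a : 'Z_k) : (a < k)%N.
Proof. exact: leq_trans (ltn_ord a) (eq_leq (Zp_cast k_ge2)). Qed.

Lemma powchar0r a : powchar a 0 = 0.
Proof. exact: mulchar0. Qed.

Lemma powcharE a x : x != 0 -> powchar a x = mulchar_ext chi x ^+ a.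
Proof. exact: mulchar_exp. Qed.

Lemma powchar0l x : x != 0 -> powchar 0 x = 1.
Proof. by move=> x0; rewrite powcharE // expr0. Qed.

Lemma powcharM a x y : powchar a (x * y) = powchar a x * powchar a y.
Proof. by apply: mulcharM; rewrite rpredX. Qed.

Lemma mulchar_expk x : x != 0 -> mulchar_ext chi x ^+ k = 1.
Proof. by move=> x0; rewrite -mulchar_exp // -chi_order exp_cforder mulchar_1l. Qed.

Lemma powcharD a b x : powchar (a + b) x = powchar a x * powchar b x.
Proof.
have [->|x0] := eqVneq x 0; first by rewrite !powchar0r mul0r.
by rewrite !powcharE // -exprD expr_mod // Zp_cast ?mulchar_expk.
Qed.

Lemma powchar_sum a : a != 0 -> \sum_x powchar a x = 0.
Proof.
move=> a0; have [u nu] : exists u, (chi ^+ a) u != 1.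
  apply/existsP; apply: contraNT a0; rewrite negb_exists => /forallP h.
  have : (#[chi]%CF %| a)%N.
    rewrite dvdn_cforder; apply/eqP/cfunP => u.
    by rewrite cfun1E inE; apply/eqP/negPn.
  rewrite chi_order -(inj_eq val_inj) -[_ == _]negbK -lt0n.
  by apply: contraL => a_gt0; rewrite gtnNdvd ?ltn_Zk.
have u0 : val u != 0 by rewrite -unitfE (valP u).
apply/eqP; rewrite -(mulrI_eq0 _ (mulfI (_ : 1 - powchar a (val u) != 0))); last first.
  by rewrite subr_eq0 eq_sym /powchar mulchar_val.
rewrite mulrBl mul1r subr_eq0 mulr_sumr (reindex_inj (mulfI u0)) /=.
by apply/eqP; apply: eq_bigr => x _; rewrite powcharM.
Qed.

(** The characters chi^a detect the k-th powers. *)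
Lemma sum_powchar x : \sum_a powchar a x = k%:R * (x \in kth_powers F k)%:R.
Proof.
have [->|x0] := eqVneq x 0.
  by rewrite big1 ?(negPf zero_notin_kth_powers) ?mulr0 // => a _; rewrite powchar0r.
rewrite kth_powersE //; set z := mulchar_ext chi x.
have -> : \sum_a powchar a x = \sum_(i < (Zp_trunc k).+2) z ^+ i.
  by apply: eq_bigr => a _; rewrite powcharE.
rewrite Zp_cast //; have [->|z1] := eqVneq z 1.
  by under eq_bigr do rewrite expr1n; rewrite sumr_const card_ord mulr1.
apply/eqP; rewrite mulr0 -(mulrI_eq0 _ (mulfI (_ : z - 1 != 0))) ?subr_eq0 //.
by rewrite -subrX1 mulchar_expk // subrr.
Qed.

Lemma sum_powcharN1 : \sum_a powchar a (-1) = 0.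
Proof. by rewrite sum_powchar (negPf opp1_notin_kth_powers) mulr0. Qed.

Lemma mulchar_opp1 : mulchar_ext chi (-1) = -1.
Proof.
have N1 : (-1 : F) != 0 by rewrite oppr_eq0 oner_eq0.
have : mulchar_ext chi (-1) ^+ 2 == 1.
  by rewrite expr2 -mulcharM // mulrNN mulr1 mulchar_1r.
rewrite sqrf_eq1 -kth_powersE // (negPf opp1_notin_kth_powers) /=.
by move/eqP.
Qed.

Lemma sgn_powchar a : sgn powchar a = (-1) ^+ a.
Proof. by rewrite /sgn powcharE ?mulchar_opp1 // oppr_eq0 oner_eq0. Qed.

(** Sums over 1 <= s < k as sums over the nonzero residues modulo k. *)
Lemma sum_Zk (P : pred nat) (f : nat -> algC) :
  \sum_(1 <= s < k | P s) f s = \sum_(s : 'Z_k | (s != 0) && P s) f s.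
Proof.
rewrite (big_nat_widenl 1 0) // -[in LHS](Zp_cast k_ge2) big_mkord.
by apply: eq_bigl => s; rewrite andbC lt0n.
Qed.

Lemma Zk_addN (s t : 'Z_k) : (t != - s) = ~~ (k %| s + t)%N.
Proof.
rewrite -addr_eq0 addrC -(inj_eq val_inj) /= /dvdn.
by rewrite [X in (_ %% X)%N](Zp_cast k_ge2).
Qed.

Lemma Zk_modn (s v : 'Z_k) : (v != s %[mod k])%N = (v != s).
Proof.
by rewrite !modn_small ?ltn_Zk.
Qed.

Lemma jacobi_powcharN (s t : 'Z_k) :
  jacobi (chi^-1 ^+ s) (chi ^+ t) = jac powchar (- s) t.
Proof.
apply: eq_bigr => x _; congr (_ * _).
rewrite (psiNl powchar0r powchar0l powcharD) exprVn mulchar_inv ?rpredX //.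
Qed.

Lemma Rsum_powchar : Rsum k chi = Jsum powchar.
Proof.
rewrite /Rsum sum_Zk; apply: eq_big => [s|s _]; first by rewrite andbT.
rewrite sum_Zk; apply: eq_bigl => t.
by rewrite Zk_addN.
Qed.

Lemma sum_triple (f : nat -> nat -> nat -> algC) :
  \sum_(1 <= s < k) \sum_(1 <= t < k) \sum_(1 <= v < k |
      [&& ~~ (k %| s + t)%N, ~~ (k %| v + t)%N & (v != s %[mod k])%N]) f s t v =
  \sum_(s : 'Z_k | s != 0) \sum_(t : 'Z_k | (t != 0) && (t != - s))
    \sum_(v : 'Z_k | [&& v != 0, v != s & v != - t]) f s t v.
Proof.
rewrite sum_Zk; apply: eq_big => [s|s _]; first by rewrite andbT.
rewrite sum_Zk; under eq_bigl => t do rewrite andbT.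
rewrite [RHS]big_mkcondr; apply: eq_bigr => t _; rewrite sum_Zk Zk_addN.
case: ifP => st; last by rewrite big_pred0 // => v; rewrite /= andbF.
apply: eq_bigl => v; rewrite /= Zk_modn [(v + t)%N]addnC -Zk_addN /=.
by rewrite [X in _ && X]andbC.
Qed.

Lemma Ssum_powchar : Ssum k chi = JJsum powchar.
Proof.
rewrite /Ssum sum_triple; apply: eq_bigr => s _; apply: eq_bigr => t _.
by apply: eq_bigr => v _; rewrite jacobi_powcharN.
Qed.

Lemma Ssum_minus_powchar : Ssum_minus k chi = JJsum_sgn powchar.
Proof.
rewrite /Ssum_minus sum_triple; apply: eq_bigr => s _; apply: eq_bigr => t _.
apply: eq_bigr => v _; rewrite jacobi_powcharN sgnD; last exact: powcharD.
by rewrite !sgn_powchar exprD.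
Qed.

(** In [greene_3F2_at1] the condition determines x from y and z, and the triples
    are parametrized by y = 1 / (ab), z = - (1 - a) / a and
    x = (1 - ab) / (a (1 - b)).  The signs chi(-1) cancel against the
    normalizing sign of [hyp3F2]. *)
Lemma hyp3F2_M05sum (t1 t2 t3 t4 t5 : 'Z_k) :
  q ^+ 2 * hyp3F2 chi (t1, t2, t3, t4, t5) 1 =
  M05sum powchar (t5 - t3 + t4 - t2 - t1) (t3 - t4) (t4 - t2) (- t1) t3.
Proof.
have lX (t : 'Z_k) : chi ^+ t \is a linear_char by rewrite rpredX.
rewrite /hyp3F2 mulrCA greene_3F2_at1 // exprD -!sgn_powchar.
rewrite -/(powchar t4 (-1)) -/(powchar t5 (-1)).
rewrite mulrA mulr_sumr M05sumE //.
have pN := psiNl powchar0r powchar0l powcharD.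
have pV := psiV powchar0r powchar0l powcharM powcharD.
have pN1 := psiNr powcharM.
pose h (p : F * F) := ((1 - p.1 * p.2) / (p.1 * (1 - p.2)), (p.1 * p.2)^-1,
  - ((1 - p.1) / p.1)).
pose h' (p : F * F * F) := ((1 - p.2)^-1, (1 - p.2) / p.1.2).
apply: (eq_reindex (h := h) (h' := h')).
  move=> [[x y] z] /= /eqP e.
  have : (x / (1 - x)) * (y / (1 - y)) * (z / (1 - z)) != 0.
    by apply: contra_eq_neq e => e; rewrite mulrNN mulrN e oppr0 eq_sym oner_eq0.
  rewrite !mulf_eq0 !invr_eq0 !negb_or.
  case/andP=> /andP[/andP[x0 x1] /andP[y0 y1]] /andP[z0 z1].
  have e2 : x * (1 - y - z) = (1 - y) * (1 - z).
    have e3 : x * y * z = - ((1 - x) * (1 - y) * (1 - z)).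
      rewrite -[(1 - x) * _ * _]mul1r -[X in X * (_ * _ * _)]e.
      by field; rewrite x1 y1 z1.
    transitivity (x * (1 - y - z) + ((1 - x) * (1 - y) * (1 - z) + x * y * z)).
      by rewrite e3 subrr addr0.
    by ring.
  have yz : 1 - y - z != 0.
    by apply: contraNneq (mulf_neq0 y1 z1) => yz; rewrite -e2 yz mulr0.
  split.
    rewrite /M05 /h' /=.
    rewrite (_ : 1 - (1 - z)^-1 = - (z / (1 - z))); last by field.
    rewrite (_ : 1 - (1 - z) / y = - ((1 - y - z) / y)); last by field.
    rewrite (_ : 1 - (1 - z)^-1 * ((1 - z) / y) = - ((1 - y) / y)); last first.
      by field; apply/andP.
    by rewrite !oppr_eq0 !mulf_eq0 !invr_eq0 !negb_or z0 z1 y0 y1 yz.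
  rewrite /h /h' /=; congr (_, _, _).
  - rewrite (_ : 1 - (1 - z)^-1 * ((1 - z) / y) = - ((1 - y) / y)); last first.
      by field; apply/andP.
    rewrite (_ : 1 - (1 - z) / y = - ((1 - y - z) / y)); last by field.
    apply: (mulIf yz); rewrite e2; field.
    by rewrite oppr_eq0 y0 z1 yz.
  - by field; rewrite y0 z1 oner_eq0.
  by field; rewrite ?z1 ?oner_eq0.
move=> [a b] /= /and5P[/= a0 b0 a1 b1 ab1]; split.
- rewrite /h /=.
  have -> : 1 - (1 - a * b) / (a * (1 - b)) = - ((1 - a) / (a * (1 - b))).
    by field; apply/andP.
  have -> : 1 - (a * b)^-1 = - ((1 - a * b) / (a * b)) by field; apply/andP.
  have -> : 1 - - ((1 - a) / a) = a^-1 by field.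
  apply/eqP; field.
  by rewrite !oppr_eq0 a0 b0 a1 b1 ab1 oner_eq0.
- rewrite /h' /h /=.
  have -> : 1 - - ((1 - a) / a) = a^-1 by field.
  by congr (_, _); rewrite ?invrK //; field; rewrite ?a0 ?b0 ?oner_eq0.
rewrite /h /=.
have -> : 1 - (a * b)^-1 = - ((1 - a * b) / (a * b)) by field; apply/andP.
have -> : 1 - - ((1 - a) / a) = a^-1 by field.
have E (t : 'Z_k) x : mulchar_ext (chi ^+ t) x = powchar t x by [].
have sq := sgn_sq powchar0l powcharM powcharD.
have allnz := psi_neq0 powchar0l powcharD.
have e0 t : sgn powchar t != 0 by rewrite allnz // oppr_eq0 oner_eq0.
rewrite !E !pN1 !powcharM !pV !powcharD !pN !powcharM.
rewrite !(psi1 powchar0l powcharM powcharD) !mulr1; set rhs := RHS.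
have -> : rhs = sgn powchar t3 * sgn powchar t3 *
    (sgn powchar t5 * sgn powchar t5 * rhs).
  by rewrite !sq !mul1r.
rewrite /rhs; field.
  by rewrite e0 !allnz.
exact: powchar0r.
Qed.

Lemma sum_Xset : q ^+ 2 * \sum_(t in Xset k) hyp3F2 chi t 1 =
  \sum_(t : 'Z_k * 'Z_k * 'Z_k * 'Z_k * 'Z_k | Xgen t) M05sum5 powchar t.
Proof.
rewrite mulr_sumr.
have XE (t1 t2 t3 t4 t5 : 'Z_k) : ((t1, t2, t3, t4, t5) \in Xset k) =
    Xgen (t5 - t3 + t4 - t2 - t1, t3 - t4, t4 - t2, - t1, t3).
  rewrite inE /Xgen /allnz !inE !negb_or oppr_eq0 !subr_eq0.
  rewrite (@eqr_of_subr _ (t5 - t3 + t4 - t2) t1 (t4 + t5) (t1 + t2 + t3));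
    last by ring.
  rewrite (@eqr_of_subr _ (t4 - t2 - t1) _ t3 t5); last by ring.
  rewrite (@eqr_of_subr _ (- t1 + t3) _ t4 t1); last by ring.
  rewrite (@eqr_of_subr _ (t3 + _) _ t5 t1); last by ring.
  rewrite (@eqr_of_subr _ (_ + (t3 - t4)) _ t5 t2); last by ring.
  rewrite (@eqr_of_subr _ (t3 - t4 + _) _ 0 t2); last by ring.
  rewrite -!andbA [t4 == t1]eq_sym [t5 == t1]eq_sym [t5 == t2]eq_sym [0 == _]eq_sym.
  rewrite [t4 == t2]eq_sym [t4 + t5 == _]eq_sym.
  by do !bool_congr.
apply: (eq_reindex
  (h := fun u : 'Z_k * 'Z_k * 'Z_k * 'Z_k * 'Z_k => let: (u1, u2, u3, u4, u5) := u in
     (- u4, u5 - u2 - u3, u5, u5 - u2, u1 + u5 - u3 - u4))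
  (h' := fun t : index5 k => let: (t1, t2, t3, t4, t5) := t in
     (t5 - t3 + t4 - t2 - t1, t3 - t4, t4 - t2, - t1, t3))).
  case=> [[[[t1 t2] t3] t4] t5]; rewrite XE => h; split=> //.
  by congr (_, _, _, _, _); ring.
case=> [[[[u1 u2] u3] u4] u5] h.
have e : (u1 + u5 - u3 - u4 - u5 + (u5 - u2) - (u5 - u2 - u3) - - u4,
   u5 - (u5 - u2), u5 - u2 - (u5 - u2 - u3), - - u4, u5) = (u1, u2, u3, u4, u5).
  by congr (_, _, _, _, _); ring.
by split; rewrite ?XE ?hyp3F2_M05sum ?e //; case: e => -> -> -> -> .
Qed.

(** * Counting the paths *)

Lemma kth_powersM x y :
  x \in kth_powers F k -> y \in kth_powers F k -> x * y \in kth_powers F k.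
Proof.
rewrite !inE => /existsP[u /andP[u0 /eqP->]] /existsP[v /andP[v0 /eqP->]].
by apply/existsP; exists (u * v); rewrite mulf_neq0 //= exprMn.
Qed.

Lemma kth_powersV x : x \in kth_powers F k -> x^-1 \in kth_powers F k.
Proof.
rewrite !inE => /existsP[u /andP[u0 /eqP->]].
by apply/existsP; exists u^-1; rewrite invr_neq0 //= exprVn.
Qed.

Lemma kth_powers_neq0 x : x \in kth_powers F k -> x != 0.
Proof. by apply: contraTneq => ->; exact: zero_notin_kth_powers. Qed.

Lemma paley_asym x y : paley_digraph k x y -> ~~ @paley_digraph F k y x.
Proof.
rewrite /paley_digraph => xy; apply/negP => yx; case/negP: opp1_notin_kth_powers.
have yx0 := kth_powers_neq0 yx.
have -> : (-1 : F) = (y - x) / (x - y) by field.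
by apply/kth_powersM/kth_powersV.
Qed.

Lemma card_kth_powers : k%:R * #|kth_powers F k|%:R = q - 1 :> algC.
Proof.
transitivity (\sum_x \sum_a powchar a x).
  under eq_bigr do rewrite sum_powchar; rewrite -mulr_sumr; congr (_ * _).
  by rewrite -sum1_card natr_sum big_mkcond; apply: eq_bigr => x _; case: ifP.
rewrite exchange_big (bigD1 0) //= [X in _ + X]big1 ?addr0; last first.
  by move=> a a0; apply: powchar_sum.
rewrite (bigD1 0) //= powchar0r add0r (eq_bigr _ powchar0l) sum_neq.
by rewrite sumr_const.
Qed.

(** The points (a, b) all of whose five coordinates are k-th powers. *)
Definition M05_kth : {set F * F} := [set p | [&& p.1 \in kth_powers F k,
  1 - p.1 * p.2 \in kth_powers F k, p.2 \in kth_powers F k,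
  (1 - p.2) / (1 - p.1 * p.2) \in kth_powers F k &
  (1 - p.1) / (1 - p.1 * p.2) \in kth_powers F k]].

Lemma in_M05_kth (p : F * F) : (p \in M05_kth) = [&& p.1 \in kth_powers F k,
  1 - p.1 * p.2 \in kth_powers F k, p.2 \in kth_powers F k,
  (1 - p.2) / (1 - p.1 * p.2) \in kth_powers F k &
  (1 - p.1) / (1 - p.1 * p.2) \in kth_powers F k].
Proof. by rewrite in_set. Qed.

Lemma sum_M05sum5 : \sum_t M05sum5 powchar t = k%:R ^+ 5 * #|M05_kth|%:R.
Proof.
rewrite -sum1_card natr_sum mulr_sumr [RHS]big_mkcond.
rewrite (eq_bigr (fun t : 'Z_k * 'Z_k * 'Z_k * 'Z_k * 'Z_k => \sum_(p : F * F)
   powchar t.1.1.1.1 p.1 * powchar t.1.1.1.2 (1 - p.1 * p.2) * powchar t.1.1.2 p.2 *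
    powchar t.1.2 ((1 - p.2) / (1 - p.1 * p.2)) *
    powchar t.2 ((1 - p.1) / (1 - p.1 * p.2)))); last by case=> [[[[? ?] ?] ?] ?].
rewrite exchange_big; apply: eq_bigr => p _ /=.
transitivity ((\sum_a powchar a p.1) * (\sum_a powchar a (1 - p.1 * p.2)) *
  (\sum_a powchar a p.2) * (\sum_a powchar a ((1 - p.2) / (1 - p.1 * p.2))) *
  (\sum_a powchar a ((1 - p.1) / (1 - p.1 * p.2)))).
  by rewrite big_distrlr /= pair_bigA big_distrlr /= pair_bigA big_distrlr /=
    pair_bigA big_distrlr /= pair_bigA.
rewrite !sum_powchar.
rewrite [RHS](_ : _ = k%:R ^+ 5 * (p \in M05_kth)%:R); last first.
  by case: ifP => _; rewrite ?mulr0.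
by rewrite in_M05_kth -!mulnb !natrM; ring.
Qed.

Lemma kth_powers_div x y :
  x \in kth_powers F k -> y \in kth_powers F k -> x / y \in kth_powers F k.
Proof. by move=> xS yS; apply/kth_powersM/kth_powersV. Qed.

(** A path is given by its first vertex x, its first step s and the coordinates
    (a, b): its vertices are x, x + s, x + s / a and x + s / (ab). *)
Lemma card_paths : #|[set a : 4.-tuple F | pairwise (paley_digraph k) a]|%:R =
  q * #|kth_powers F k|%:R * #|M05_kth|%:R :> algC.
Proof.
rewrite -!natrM -cardsT -!cardsX -!sum1_card !natr_sum.
pose h (u : F * F * (F * F)) : 4.-tuple F := [tuple u.1.1; u.1.1 + u.1.2;
  u.1.1 + u.1.2 / u.2.1; u.1.1 + u.1.2 / (u.2.1 * u.2.2)].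
pose h' (a : 4.-tuple F) : F * F * (F * F) :=
  (a`_0, a`_1 - a`_0, ((a`_1 - a`_0) / (a`_2 - a`_0), (a`_2 - a`_0) / (a`_3 - a`_0))).
apply: (eq_reindex (h := h) (h' := h')).
  move=> a; rewrite [a \in _]in_set !(in_setX, in_setT) in_M05_kth.
  case/tupleP: a => x0 a; case/tupleP: a => x1 a; case/tupleP: a => x2 a.
  case/tupleP: a => x3 a; rewrite (tuple0 a) /= /paley_digraph !andbT.
  case/and3P=> /and3P[d1 d2 d3] /andP[d12 d13] d23.
  have n1 := kth_powers_neq0 d1; have n2 := kth_powers_neq0 d2.
  have n3 := kth_powers_neq0 d3; have n13 := kth_powers_neq0 d13.
  have e12 : 1 - (x1 - x0) / (x2 - x0) * ((x2 - x0) / (x3 - x0)) =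
      (x3 - x1) / (x3 - x0).
    by field; rewrite n2 n3.
  split.
    rewrite e12.
    rewrite (_ : 1 - (x2 - x0) / (x3 - x0) = (x3 - x2) / (x3 - x0)); last by field.
    rewrite (_ : 1 - (x1 - x0) / (x2 - x0) = (x2 - x1) / (x2 - x0)); last by field.
    by rewrite d1 !kth_powers_div.
  apply/val_inj; rewrite /h /h' /=; congr [:: _; _; _; _].
  - by ring.
  - by field; rewrite ?n1 ?n2.
  by field; rewrite ?n1 ?n2 ?n3.
move=> [[x s] [a b]].
rewrite !(in_setX, in_setT) in_M05_kth [h _ \in _]in_set /=.
case/andP=> sS /and5P[aS abS bS b1S a1S].
have n1 := kth_powers_neq0 sS; have n2 := kth_powers_neq0 aS.
have n3 := kth_powers_neq0 bS; have n4 := kth_powers_neq0 abS.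
have {b1S} b1 : 1 - b \in kth_powers F k by rewrite -(divfK n4 (1 - b)) kth_powersM.
have {a1S} a1 : 1 - a \in kth_powers F k by rewrite -(divfK n4 (1 - a)) kth_powersM.
have d1 : x + s - x = s by ring.
have d2 : x + s / a - x = s / a by ring.
have d3 : x + s / (a * b) - x = s / (a * b) by ring.
split=> //.
- rewrite /paley_digraph !andbT d1 d2 d3.
  rewrite (_ : x + s / a - (x + s) = s * (1 - a) / a); last by field.
  rewrite (_ : x + s / (a * b) - (x + s) = s * (1 - a * b) / (a * b)); last first.
    by field; rewrite n2 n3.
  rewrite (_ : x + s / (a * b) - (x + s / a) = s * (1 - b) / (a * b)); last first.
    by field; rewrite n2 n3.
  by rewrite sS !(kth_powers_div, kth_powersM).
rewrite /h' /= d1 d2 d3; congr (_, _, (_, _)).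
  by field; rewrite n1 n2.
by field; rewrite n1 n2 n3.
Qed.

Lemma num_transitive4_M05sum :
  (num_transitive_subtournaments 4 (paley_digraph (F := F) k))%:R =
  q * (q - 1) / k%:R ^+ 6 * \sum_t M05sum5 powchar t.
Proof.
have k0 : (k%:R : algC) != 0 by rewrite pnatr_eq0 -lt0n ltnW.
rewrite (num_transitive_subtournamentsE _ paley_asym) card_paths sum_M05sum5.
by rewrite -card_kth_powers; field.
Qed.
End OrderK.

Theorem theorem2p2 (k : nat) (F : finFieldType) (chi : 'CF([set: {unit F}]))
    (k_ge2 : (2 <= k)%N) (k_even : ~~ odd k)
    (q_mod : (#|F| = k + 1 %[mod 2 * k])%N)
    (chi_char : chi \is a linear_char) (chi_order : #[chi]%CF = k) :
  let q : algC := #|F|%:R in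
  let K : algC := k%:R in
  let RR := Rsum k chi in
  let SS := Ssum k chi in
  let SSm := Ssum_minus k chi in
  (num_transitive_subtournaments 4 (paley_digraph (F := F) k))%:R =
  q * (q - 1) / K ^+ 6 *
  (10 * RR ^+ 2 + 5 * (q - K ^+ 2 + 1) * RR - 10 * SS - 5 * SSm
   + q ^+ 2 - 10 * (K - 1) ^+ 2 * q + 5 * K ^+ 2 * (K - 1) + 1
   + q ^+ 2 * \sum_(t in Xset k) hyp3F2 chi t 1).
Proof.
cbv zeta; rewrite (num_transitive4_M05sum k_ge2 k_even q_mod chi_char chi_order).
rewrite (Rsum_powchar chi k_ge2) Ssum_powchar // Ssum_minus_powchar // sum_Xset //.
rewrite (sum_M05sum_complement (psi := powchar chi)) ?card_Zk //.
- exact: powchar0r.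
- exact: powchar0l.
- exact: powcharM.
- exact: powcharD.
- exact: powchar_sum.
exact: sum_powcharN1.
Qed.
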